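(* Let $G$ be a non-locally compact topological group, let $bG$ be a Hausdorff compactification of $G$, and suppose that the remainder $Y=bG\setminus G$ has locally a point-countable $p$-metabase. Then $G$ and $bG$ are separable and metrizable spaces.
   Context: All spaces are assumed to be Tychonoff. A family $\mathcal{A}$ of subsets of a space $X$ is a $p$-metabase for $X$ if for any distinct points $x,y\in X$ there is a finite subfamily $\mathcal{F}\subset\mathcal{A}$ such that $x\in(\bigcup\mathcal{F})^{\circ}\subset\bigcup\mathcal{F}\subset X\setminus\{y\}$, where $^\circ$ denotes interior in $X$. It is point-countable if each point of $X$ belongs to at most countably many members of $\mathcal{A}$. A space $Y$ has locally a point-countable $p$-metabase if each $y\in Y$ has an open neighborhood $U_y$ in $Y$ such that the subspace $U_y$ has a point-countable $p$-metabase. *)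

(* Defs.v *)
From HB Require Import structures.
From mathcomp Require Import all_boot all_order all_algebra.
From mathcomp Require Import all_classical all_reals all_analysis.

Set Implicit Arguments.
Unset Strict Implicit.
Unset Printing Implicit Defensive.

Import Order.TTheory GRing.Theory Num.Theory.

Local Open Scope classical_set_scope.
Local Open Scope ring_scope.

(* Multiplicative (not necessarily abelian) topological groups; no separation
   axiom is built in. *)
HB.mixin Record isTopologicalGroup G & Topological G & Group G := {
  mulg_continuous : continuous (fun xy : G * G => (xy.1 * xy.2)%g) ;
  invg_continuous : continuous (fun x : G => (x^-1)%g)
}.

#[short(type="topologicalGroupType")]
HB.structure Definition TopologicalGroup :=
  {G of Topological G & Group G & isTopologicalGroup G}.

Definition tychonoff_space (X : topologicalType) : Prop :=
  accessible_space X /\ completely_regular_space X.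

Definition separable (X : topologicalType) : Prop :=
  exists2 D : set X, countable D & dense D.

Definition is_metric (R : realType) (X : Type) (d : X -> X -> R) : Prop :=
  [/\ forall x y, 0 <= d x y,
      forall x y, d x y = 0 <-> x = y,
      forall x y, d x y = d y x
    & forall x y z, d x z <= d x y + d y z].

Definition metrizable (R : realType) (X : topologicalType) : Prop :=
  exists2 d : X -> X -> R, is_metric d &
    forall x : X, nbhs x = nbhs_ball_ (fun y e => [set z | d y z < e]) x.

Definition topological_embedding (X Y : topologicalType) (f : X -> Y) : Prop :=
  [/\ injective f,
      continuous f
    & forall U : set X, open U ->
        exists2 V : set Y, open V & f @` U = V `&` range f].

Definition hausdorff_compactification (X K : topologicalType) (i : X -> K)
    : Prop :=
  [/\ compact [set: K], hausdorff_space K, topological_embedding i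
    & dense (range i)].

(* The coercion from sets to types gives [remainder i], and below open
   neighborhoods [U], the subspace topology of [subtype_topology]. *)
Definition remainder (X K : Type) (i : X -> K) : set K := ~` range i.

Definition p_metabase (X : topologicalType) (A : set (set X)) : Prop :=
  forall x y : X, x <> y ->
    exists F : set (set X),
      [/\ finite_set F, F `<=` A, (\bigcup_(B in F) B)° x
        & \bigcup_(B in F) B `<=` ~` [set y]].

Definition point_countable (X : Type) (A : set (set X)) : Prop :=
  forall x : X, countable [set B | A B /\ B x].

Definition has_point_countable_p_metabase (X : topologicalType) : Prop :=
  exists2 A : set (set X), p_metabase A & point_countable A.

Definition has_locally_point_countable_p_metabase (Y : topologicalType)
    : Prop :=
  forall y : Y, exists2 U : set Y, open_nbhs y U &
    has_point_countable_p_metabase U.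

(* Main.v *)
Require Import Defs.
From mathcomp Require Import all_boot all_order all_algebra.
From mathcomp Require Import all_classical all_reals all_analysis.
From mathcomp Require Import lra.

(** Let [K] be the compactification and [Y] the remainder. As [G] is homogeneous
    and not locally compact, [Y] is dense in [K]. The proof combines two ideas.

    The first one is a refinement of the classical lemma of Mishchenko. A finite
    union of members of a point-countable family can be traced on a set [M] by the
    members that meet [M], and a countable [M] has only countably many finite
    sets of such members, so that one can close [M] off as if it was an elementary
    submodel. In this way, if two subspaces of a compact space have point-countable
    p-metabases and their union contains the closures of its countable subsets,
    then this union is closed ([traced_omega_closed]). In particular [Y] cannot
    contain the closures of all its countable subsets: it would be locally
    compact, hence open. And a compact space covered by two such subspaces is
    countably tight, which makes the points of each of them G-delta points of this
    subspace ([traced_tight], [traced_Gdelta]).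

    The second idea is a partial multiplication on [K]. For [c] in [Y] and [h] in
    [G], the limits of the products [g * h] with [g] tending to [c] form a compact
    subset of [Y] that depends upper semicontinuously on [c] and [h]. Since some
    sequence [C n] in [Y] accumulates at a point of [G], these limits for
    [c = C n] tell the points [h] apart, and they pull the p-metabase of [Y] back
    to a G-delta part of [G] ([traced_separation_transport]). Thus small closed
    G-delta subsets of [K] are covered by two subspaces, one in [G] and one in [Y],
    with such families. By the first part they are countably tight and have enough
    G-delta points to provide a countable pi-base at a point of [G], hence a
    countable base at the unit ([countable_pi_base], [group_first_countable]).

    The rest is about countable networks. A compact subset of [Y] is locally
    second countable, which forces uniformly discrete subsets of [G] to be
    countable ([group_narrow]): push them slightly into [Y], where they have a
    compact closure. So [G] has a countable base. This makes [Y] a Lindelof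
    Sigma-space, and such a space with a point-countable p-metabase has a countable
    network ([traced_network], [compactification_network]). Hence so has [K], and
    a compact Hausdorff space with a countable network is separable and metrizable;
    [G] inherits both through the network and the metric of [K]. *)

Set Implicit Arguments.
Unset Strict Implicit.
Unset Printing Implicit Defensive.

Import Order.TTheory GRing.Theory Num.Theory.
Import numFieldNormedType.Exports.

Local Open Scope classical_set_scope.

(** * Compact Hausdorff spaces *)

Section CompactTools.
Context {T : topologicalType}.
Implicit Types (x y z : T) (A B D O U V : set T).

Lemma closure_meets A x O : closure A x -> open O -> O x ->
  exists2 y, A y & O y.
Proof. by move=> Ax oO Ox; have [y []] := Ax _ (open_nbhs_nbhs (conj oO Ox)); exists y. Qed.

Lemma closure_of_open A x : (forall O, open O -> O x -> exists2 y, A y & O y) ->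
  closure A x.
Proof.
move=> h B; rewrite nbhsE => -[ O [ oO Ox] OB].
by have [y Ay Oy] := h _ oO Ox; exists y; split => //; exact: OB.
Qed.

(** Induction over open covers: a property of open sets that holds locally on a
    compact set and passes to binary unions holds on a neighbourhood of it. *)
Lemma compact_local_to_global (D : set T) (Phi : set (set T)) :
  compact D -> Phi set0 ->
  (forall U V, open U -> open V -> Phi U -> Phi V -> Phi (U `|` V)) ->
  (forall x, D x -> exists V, [/\ open V, V x & Phi V]) ->
  exists V, [/\ open V, D `<=` V & Phi V].
Proof.
move=> cD P0 PU Ploc; apply: contrapT => noV.
pose F := filter_from [set V | open V /\ Phi V] (fun V => D `\` V).
have FF : Filter F.
  apply: filter_from_filter; first by exists set0; split => //; exact: open0.
  move=> U V [ oU PhiU] [ oV PhiV]; exists (U `|` V).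
    by split; [exact: openU | exact: PU].
  by move=> x [Dx nUV]; split; split => // h; apply: nUV; [left|right].
have PF : ProperFilter F.
  apply: filter_from_proper => // V [ oV PhiV].
  apply: contrapT => h; apply: noV; exists V; split=> // x Dx.
  by apply: contrapT => nVx; apply: h; exists x.
have [x [Dx clx]] : D `&` cluster F !=set0.
  by apply: cD; exists set0; [split=> //; exact: open0 | move=> ? []].
have [V [ oV Vx PhiV]] := Ploc x Dx.
have [y [[_ nVy] Vy]] : (D `\` V) `&` V !=set0.
  by apply: clx; [exists V|exact: open_nbhs_nbhs].
exact: nVy.
Qed.

Context (hT : hausdorff_space T) (cT : compact [set: T]).

Lemma closed_compactT A : closed A -> compact A.
Proof. by move=> cA; exact: (subclosed_compact cA cT). Qed.

Lemma shrink_nbhs x O : open O -> O x ->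
  exists V, [/\ open V, V x & closure V `<=` O].
Proof.
move=> oO Ox.
have [V nV cV] := compact_regular hT cT (filterT : nbhs x [set: T])
  (open_nbhs_nbhs (conj oO Ox)).
exists V°; split; [exact: open_interior| exact: nV |].
by apply: (subset_trans _ cV); apply: closureS; exact: interior_subset.
Qed.

Lemma shrink_compact (D O : set T) : compact D -> open O -> D `<=` O ->
  exists V, [/\ open V, D `<=` V & closure V `<=` O].
Proof.
move=> cD oO DO.
have [|U V _ _ hU hV|x /DO Ox|V [ oV DV VO]] :=
  @compact_local_to_global D [set V | closure V `<=` O] cD.
- by rewrite /= closure0.
- by rewrite /= closureU => x []; [exact: hU | exact: hV].
- exact: shrink_nbhs.
- by exists V.
Qed.

Lemma open_separation x y : x <> y -> exists U V,
  [/\ open U, open V, U x, V y & U `&` V = set0].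
Proof.
move=> /eqP xy; have := hT; rewrite open_hausdorff => /(_ x y xy).
by case=> -[U V] /= [/set_mem Ux /set_mem Vy] [ oU oV /eqP UV]; exists U, V.
Qed.

(** In a compact space a filter is eventually inside every neighbourhood of its
    cluster set; otherwise its traces outside of [O] would have a cluster point
    there. *)
Lemma cluster_sub_open (F : set_system T) O : Filter F -> open O ->
  cluster F `<=` O -> F O.
Proof.
move=> FF oO FO; apply: contrapT => nFO.
pose H := filter_from F (fun A => A `\` O).
have HF : Filter H.
  apply: filter_from_filter; first by exists setT; exact: filterT.
  move=> A B FA FB; exists (A `&` B); first exact: filterI.
  by move=> x [[Ax Bx] nOx].
have PH : ProperFilter H.
  apply: filter_from_proper => // A FA; apply: contrapT => h; apply: nFO.
  apply: filterS FA => x Ax; apply: contrapT => nOx; apply: h; by exists x.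
have [x [_ Hx]] : [set: T] `&` cluster H !=set0 by apply: cT; exact: filterT.
have Ox : O x.
  apply: FO => A B FA nB; have [|y [[Ay _] By]] := Hx (A `\` O) B _ nB.
    by exists A.
  by exists y.
have [] := Hx (setT `\` O) O _ (open_nbhs_nbhs (conj oO Ox)).
  by exists setT => //; exact: filterT.
by move=> y [[]].
Qed.

(** Through this lemma a countable intersection of neighbourhoods is shrunk to a
    closed one that is still a G-delta: [\bigcap_n B n] is closed because each
    [B n] contains the closure of the next. *)
Lemma nested_nbhs x (U : nat -> set T) :
  (forall n, open (U n) /\ U n x) -> exists B : nat -> set T,
  [/\ forall n, open (B n) /\ B n x, forall n, closure (B n.+1) `<=` B n
    & forall n, closure (B n) `<=` U n].
Proof.
move=> hU.
have /choice[sh hsh] : forall O : set T, exists V, open O /\ O x ->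
    [/\ open V, V x & closure V `<=` O].
  move=> O; have [[ oO Ox]|nO] := pselect (open O /\ O x); last by exists set0.
  by have [V hV] := shrink_nbhs oO Ox; exists V.
pose B := fix B n := if n is m.+1 then sh (B m `&` U n) else sh (U 0).
have hB n : open (B n) /\ B n x.
  elim: n => [|n [ oB Bx]] /=.
    by have [? ? ?] := hsh _ (hU 0).
  have [ oU Ux] := hU n.+1.
  by have [? ? ?] := hsh _ (conj (openI oB oU) (conj Bx Ux)).
have hBS n : closure (B n.+1) `<=` B n `&` U n.+1.
  have [ oU Ux] := hU n.+1; have [ oB Bx] := hB n.
  by have [_ _] := hsh _ (conj (openI oB oU) (conj Bx Ux)).
exists B; split=> // [n y /hBS[]//|[|n] y]; last by move=> /hBS[].
by have [_ _] := hsh _ (hU 0); exact.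
Qed.

Lemma nested_closed (B : nat -> set T) :
  (forall n, closure (B n.+1) `<=` B n) -> closed (\bigcap_n B n).
Proof.
move=> hB x cx n _; apply: hB; apply: closureS cx => y; exact.
Qed.

(** In a compact space a G-delta point has a countable base. *)
Lemma nested_base (B : nat -> set T) x : (forall n, closure (B n.+1) `<=` B n) ->
  (forall y, (forall n, B n y) -> y = x) ->
  forall O, open O -> O x -> exists n, B n `<=` O.
Proof.
move=> hB hx O oO Ox.
have hBS n : B n.+1 `<=` B n by apply: (subset_trans _ (hB n)); exact: subset_closure.
have hBle m n : (m <= n)%N -> B n `<=` B m.
  elim: n => [|n IH]; first by rewrite leqn0 => /eqP->.
  rewrite leq_eqVlt => /orP[/eqP->//|]; rewrite ltnS => /IH.
  by apply: subset_trans; exact: hBS.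
pose F := filter_from [set: nat] B.
have FF : Filter F.
  apply: filter_from_filter; first by exists 0.
  move=> m n _ _; exists (maxn m n) => // y By.
  by split; apply: hBle By; rewrite (leq_maxl, leq_maxr).
have [|n _ BnO] := cluster_sub_open FF oO; last by exists n.
move=> y Fy; rewrite (hx y)// => n; apply: hB => V nV.
by apply: Fy => //; exists n.+1.
Qed.

End CompactTools.

(** * Countable closing off *)

Lemma countable_setU (T : Type) (A B : set T) :
  countable A -> countable B -> countable (A `|` B).
Proof.
move=> cA cB; rewrite -bigcup2E; apply: bigcup_countable => // -[|[|n]] _ //=.
Qed.

Lemma countable_subset (T : Type) (A B : set T) :
  A `<=` B -> countable B -> countable A.
Proof. by move=> AB; apply: sub_countable; exact: subset_card_le. Qed.

Lemma countable_image (T U : Type) (f : T -> U) (A : set T) :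
  countable A -> countable (f @` A).
Proof. by apply: sub_countable; exact: card_image_le. Qed.

Lemma countable_enum (A : Type) (a0 : A) (S : set A) : countable S ->
  exists b : nat -> A, (forall n, S (b n) \/ b n = a0) /\
    forall a, S a -> exists n, b n = a.
Proof.
move=> /countable_injP[f fI].
have /choice[b hb] : forall n, exists a, (S a \/ a = a0) /\
    ((exists2 c, S c & f c = n) -> S a /\ f a = n).
  move=> n; have [[c Sc fc]|no] := pselect (exists2 c, S c & f c = n).
    by exists c; split; [left|].
  by exists a0; split; [right|].
exists b; split=> [n|a Sa]; first by have [] := hb n.
have [_ [|Sb fb]] := hb (f a); first by exists a.
by exists (f a); apply: fI => //; exact/mem_set.
Qed.

Section ClosingOff.
Context {T : choiceType}.
Implicit Types (M S : set T) (s : seq (T * nat)).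

(** A letter [(m, k)] names the [k]-th member through [m] of a point-countable
    family; a word over [M] then names a finite subfamily whose members all
    meet [M]. There are only countably many words over a countable set. *)
Definition word_in M s := forall p, p \in s -> M p.1.

Lemma word_in_cat M s t : word_in M s -> word_in M t -> word_in M (s ++ t).
Proof. by move=> hs ht p; rewrite mem_cat => /orP[/hs|/ht]. Qed.

Lemma word_inS M M' s : M `<=` M' -> word_in M s -> word_in M' s.
Proof. by move=> MM' h p /h /MM'. Qed.

Lemma countable_word_in M : countable M -> countable [set s | word_in M s].
Proof.
move=> /countable_injP[f fI]; apply/countable_injP.
exists (fun s => pickle [seq (f p.1, p.2) | p <- s]) => s t /set_mem os /set_mem ot.
move=> /(pcan_inj pickleK).
elim: s t os ot => [|[a m] s IH] [|[b n] t] //= os ot [fab mn st].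
have ab : a = b.
  apply: fI => //; apply/mem_set.
    by apply: (os (a, m)); rewrite mem_head.
  by apply: (ot (b, n)); rewrite mem_head.
rewrite ab mn (IH t) //.
- by move=> p ps; apply: os; rewrite in_cons ps orbT.
- by move=> p ps; apply: ot; rewrite in_cons ps orbT.
Qed.

(** A countable [M] closed under countably-valued operations on words is the
    substitute for a countable elementary submodel. *)
Lemma closing_off S (Op : seq (T * nat) -> seq (T * nat) -> set T) M0 :
  (forall s t, countable (Op s t)) -> (forall s t, Op s t `<=` S) ->
  countable M0 -> M0 `<=` S ->
  exists M, [/\ countable M, M0 `<=` M, M `<=` S &
    forall s t, word_in M s -> word_in M t -> Op s t `<=` M].
Proof.
move=> cOp OpS cM0 M0S.
pose next M := M `|` \bigcup_(s in [set s | word_in M s])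
   \bigcup_(t in [set t | word_in M t]) Op s t.
pose Mn n := iter n next M0.
have cMn n : countable (Mn n).
  elim: n => // n IH; rewrite /Mn /= -/(Mn n) /next.
  apply: countable_setU => //; apply: bigcup_countable => [|s _].
    exact: countable_word_in.
  by apply: bigcup_countable => [|t _]; [exact: countable_word_in|exact: cOp].
have MnS n : Mn n `<=` S.
  elim: n => // n IH x [/IH//|[s _ [t _]]]; exact: OpS.
have Mle m n : (m <= n)%N -> Mn m `<=` Mn n.
  elim: n => [|n IH]; first by rewrite leqn0 => /eqP->.
  rewrite leq_eqVlt => /orP[/eqP->//|]; rewrite ltnS => /IH h x /h; by left.
exists (\bigcup_n Mn n); split.
- by apply: bigcup_countable.
- by move=> x M0x; exists 0.
- by move=> x [n _]; exact: MnS.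
- have over_stage s : word_in (\bigcup_n Mn n) s -> exists n, word_in (Mn n) s.
    elim: s => [|p s IH] os; first by exists 0.
    have [|n hn] := IH; first by move=> q qs; apply: os; rewrite in_cons qs orbT.
    have [k _ hk] := os p (mem_head _ _).
    exists (maxn n k) => q; rewrite in_cons => /orP[/eqP->|/hn].
      by apply: Mle hk; rewrite leq_maxr.
    by apply: Mle; rewrite leq_maxl.
  move=> s t /over_stage[m hm] /over_stage[n hn] x Ox.
  exists (maxn m n).+1 => //; right; exists s; last exists t => //.
    by apply: word_inS hm; apply: Mle; rewrite leq_maxl.
  by apply: word_inS hn; apply: Mle; rewrite leq_maxr.
Qed.

End ClosingOff.

(** * Traced separation *)

Section Traced.
Context {T : topologicalType}.
Implicit Types (x y z : T) (M Z P O : set T) (e : T -> nat -> set T)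
  (s t : seq (T * nat)).

Definition word_union e s := [set x | exists2 p, p \in s & e p.1 p.2 x].

Lemma word_union_cat e s t : word_union e (s ++ t) = word_union e s `|` word_union e t.
Proof.
apply/seteqP; split=> x.
  by move=> [p]; rewrite mem_cat => /orP[] ps ex; [left|right]; exists p.
by move=> [] [p ps ex]; exists p => //; rewrite mem_cat ps ?orbT.
Qed.

(** [P] behaves like a finite union of members of the family named by [e]: on
    every set [M] it is cut out by the finitely many members of that union that
    meet [M]. Finite unions of members of a point-countable family are the model
    case, and they are only ever used through this property, which is stable
    under taking preimages by arbitrary functions. *)
Definition traced Z e P := forall M, exists s,
  [/\ word_in M s, word_union e s `<=` P & P `&` M `&` Z `<=` word_union e s].

(** The form in which a point-countable p-metabase of the subspace [Z] is used. *)
Definition traced_separation Z e := forall x y, Z x -> Z y -> x <> y ->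
  exists O P, [/\ open O, O x, traced Z e P, O `&` Z `<=` P & ~ P y].

Lemma traced0 Z e : traced Z e set0.
Proof. by move=> M; exists [::]; split => // x [] //; move=> []. Qed.

Lemma tracedU Z e P Q : traced Z e P -> traced Z e Q -> traced Z e (P `|` Q).
Proof.
move=> tP tQ M; have [s [ os sP Ps]] := tP M; have [t [ ot tQ' Qt]] := tQ M.
exists (s ++ t); split; first exact: word_in_cat.
  by rewrite word_union_cat; apply: setUSS.
by move=> x [[[Px|Qx] Mx] Zx]; rewrite word_union_cat; [left; apply: Ps|right; apply: Qt].
Qed.

Lemma traced_separationS Z Z' e : Z' `<=` Z -> traced_separation Z e ->
  traced_separation Z' e.
Proof.
move=> Z'Z h x y /Z'Z Zx /Z'Z Zy xy; have [ O [P [ oO Ox tP OP nPy]]] := h _ _ Zx Zy xy.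
exists O, P; split=> // [M|z [Oz /Z'Z Zz]]; last exact: OP.
have [s [ os sP Ps]] := tP M; exists s; split=> // z [PMz /Z'Z Zz]; exact: Ps.
Qed.

Context (hT : hausdorff_space T) (cT : compact [set: T]).

Lemma compact_traced Z e D y : traced_separation Z e -> compact D -> D `<=` Z ->
  Z y -> ~ D y -> exists O P,
  [/\ open O, D `<=` O, traced Z e P, closure O `&` Z `<=` P & ~ P y].
Proof.
move=> hZ cD DZ Zy nDy.
pose Phi := [set V : set T | exists P,
  [/\ traced Z e P, closure V `&` Z `<=` P & ~ P y]].
have [|U V _ _ [P [tP UP nPy]] [Q [tQ VQ nQy]]|x Dx|] := @compact_local_to_global T D Phi cD.
- by exists set0; split; [exact: traced0| rewrite closure0; move=> ? []|].
- exists (P `|` Q); split; [exact: tracedU| |by move=> []].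
  by rewrite closureU setIUl; exact: setUSS.
- have [|O [P [ oO Ox tP OP nPy]]] := hZ x y (DZ x Dx) Zy.
    by move=> xy; apply: nDy; rewrite -xy.
  have [V [ oV Vx cV]] := shrink_nbhs hT cT oO Ox.
  exists V; split=> //; exists P; split=> // z [/cV Oz Zz]; exact: OP.
- by move=> V [ oV DV [P [tP VP nPy]]]; exists V, P.
Qed.

(** The sets [V1] and [V2] are themselves added to the family, to separate the
    points of one of them from those outside of it; they are encoded by the
    numbers 0 and 1, and the two given families by the remaining even and odd
    numbers. *)
Lemma traced_separationU Y V1 V2 e1 e2 : open V1 -> open V2 ->
  traced_separation (V1 `&` Y) e1 -> traced_separation (V2 `&` Y) e2 ->
  exists e, traced_separation ((V1 `|` V2) `&` Y) e.
Proof.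
move=> oV1 oV2 h1 h2.
pose e m k := if k is k'.+1 then
  (if odd k' then V1 `&` e1 m k'./2 else V2 `&` e2 m k'./2) else
  (if pselect (V1 m) then V1 else V2).
pose e' m k := if k is k'.+1 then e m k' else V2.
exists e'.
set Z := (V1 `|` V2) `&` Y.
have tV1 : traced Z e' V1.
  move=> M; have [[m [Mm Vm]]|no] := pselect (exists m, M m /\ V1 m).
    exists [:: (m, 1)]; split.
    - by move=> p; rewrite inE => /eqP ->.
    - by move=> x [p]; rewrite inE => /eqP -> /=; case: pselect.
    - move=> x [[V1x _] _]; exists (m, 1); rewrite ?mem_head//=.
      by case: pselect.
  exists [::]; split=> // [x []//|x [[V1x Mx] _]]; exfalso; apply: no; by exists x.
have tV2 : traced Z e' V2.
  move=> M; have [[m Mm]|no] := pselect (exists m, M m).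
    exists [:: (m, 0)]; split.
    - by move=> p; rewrite inE => /eqP ->.
    - by move=> x [p]; rewrite inE => /eqP -> /=.
    - by move=> x [[V2x _] _]; exists (m, 0); rewrite ?mem_head//=.
  exists [::]; split=> // [x []//|x [[V1x Mx] _]]; exfalso; apply: no; by exists x.
have t1 P : traced (V1 `&` Y) e1 P -> traced Z e' (V1 `&` P).
  move=> tP M; have [s [ os sP Ps]] := tP M.
  exists [seq (p.1, p.2.*2.+3) | p <- s]; split.
  - by move=> _ /mapP[p ps ->] /=; exact: os.
  - move=> x [_ /mapP[p ps ->]] /=; rewrite odd_double/= uphalf_double => -[V1x ex].
    by split=> //; apply: sP; exists p.
  - move=> x [[[V1x Px] Mx] [_ Yx]]; have [//|p ps ex] := Ps x.
    exists (p.1, p.2.*2.+3); first by apply/mapP; exists p.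
    by rewrite /= odd_double/= uphalf_double.
have t2 P : traced (V2 `&` Y) e2 P -> traced Z e' (V2 `&` P).
  move=> tP M; have [s [ os sP Ps]] := tP M.
  exists [seq (p.1, p.2.*2.+2) | p <- s]; split.
  - by move=> _ /mapP[p ps ->] /=; exact: os.
  - move=> x [_ /mapP[p ps ->]] /=; rewrite odd_double/= doubleK => -[V1x ex].
    by split=> //; apply: sP; exists p.
  - move=> x [[[V1x Px] Mx] [_ Yx]]; have [//|p ps ex] := Ps x.
    exists (p.1, p.2.*2.+2); first by apply/mapP; exists p.
    by rewrite /= odd_double/= doubleK.
move=> x y [Vx Yx] [Vy Yy] xy; case: Vx => Vx.
- have [V1y|nV1y] := pselect (V1 y).
    have [ O [P [ oO Ox tP OP nPy]]] := h1 x y (conj Vx Yx) (conj V1y Yy) xy.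
    exists (O `&` V1), (V1 `&` P); split; [exact: openI|by []|exact: t1| |by case].
    by move=> z [[Oz V1z] [_ Yz]]; split => //; apply: OP.
  by exists V1, V1; split=> // z [].
- have [V2y|nV2y] := pselect (V2 y).
    have [ O [P [ oO Ox tP OP nPy]]] := h2 x y (conj Vx Yx) (conj V2y Yy) xy.
    exists (O `&` V2), (V2 `&` P); split; [exact: openI|by []|exact: t2| |by case].
    by move=> z [[Oz V1z] [_ Yz]]; split => //; apply: OP.
  by exists V2, V2; split=> // z [].
Qed.

Definition locally_traced Y := forall y, Y y ->
  exists O e, [/\ open O, O y & traced_separation (O `&` Y) e].

Lemma compact_locally_traced Y D : locally_traced Y -> compact D -> D `<=` Y ->
  exists V e, [/\ open V, D `<=` V & traced_separation (V `&` Y) e].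
Proof.
move=> hY cD DY.
pose Phi := [set V : set T | exists e, traced_separation (V `&` Y) e].
have [||x /DY/hY[ O [e [ oO Ox h]]]|V [ oV DV [e he]]] := @compact_local_to_global T D Phi cD.
- by exists (fun _ _ => set0) => x y [].
- move=> U V oU oV [e1 h1] [e2 h2]; exact: (traced_separationU oU oV h1 h2).
- by exists O; split => //; exists e.
- by exists V, e.
Qed.

End Traced.

(** * Countable tightness *)

Section Tightness.
Context {T : topologicalType} (hT : hausdorff_space T) (cT : compact [set: T]).
Implicit Types (x y z w q : T) (M X Z : set T) (e : T -> nat -> set T).

(** Closing [M] off makes all the sets [(M `&` X) `\` word_union e s] nonempty,
    where [s] runs over the words that do not cover the given point [q] of [X].
    The cluster points of this filter are the limits of [M] towards [q]. *)
Definition tail e M X q : set_system T :=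
  filter_from [set s | word_in M s /\ ~ word_union e s q]
    (fun s => (M `&` X) `\` word_union e s).

Lemma tail_filter e M X q : Filter (tail e M X q).
Proof.
apply: filter_from_filter; first by exists [::]; split=> [p//|[p]].
move=> s t [ os sq] [ ot tq]; exists (s ++ t).
  by split; [exact: word_in_cat | rewrite word_union_cat => -[]].
by move=> x [MXx]; rewrite word_union_cat => /not_orP[nsx ntx]; split; split.
Qed.

Lemma tail_cluster_meets e M X q z s O : word_in M s -> ~ word_union e s q ->
  cluster (tail e M X q) z -> open O -> O z ->
  exists2 x, ((M `&` X) `\` word_union e s) x & O x.
Proof.
move=> os sq Cz oO Oz.
have [|x [hx Ox]] := Cz ((M `&` X) `\` word_union e s) O _ (open_nbhs_nbhs (conj oO Oz)).
  by exists s.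
by exists x.
Qed.

(** A neighbourhood of [z] that avoids [q] is covered by a traced set [P], and
    the trace of [P] on [M] is a word that does not cover [q]: so the filter
    leaves this neighbourhood. *)
Lemma tail_cluster_disjoint e M X Z q z : traced_separation Z e -> X `<=` Z ->
  Z q -> Z z -> z <> q -> ~ cluster (tail e M X q) z.
Proof.
move=> hZ XZ Zq Zz zq Cz; have [V [P [ oV Vz tP VP nPq]]] := hZ _ _ Zz Zq zq.
have [s [ os sP Ps]] := tP M.
have [|x [[Mx Xx] nsx] Vx] := tail_cluster_meets os _ Cz oV Vz; first by move=> /sP.
by apply: nsx; apply: Ps; split; [split=> //; apply: VP; split=> //|]; exact: XZ.
Qed.

Definition omega_closed Z := forall D, countable D -> D `<=` Z -> closure D `<=` Z.

(** Suppose that [w] is in the closure of [Z1] but not in [Z1 `|` Z2]. Two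
    countable sets [M0] and [M1] containing [M0] are closed off, and [q] in [Z1]
    is chosen outside of both closures and close to [w], in an open [V] whose
    closure misses that of [M0]. By [tail_cluster_disjoint] the tails of [M0] and
    of [M1] (the latter within [V]) towards [q] cluster only in [Z2]. Let [r] be a
    cluster point of the second tail. Since [r] is not in the closure of [M0], the
    family on [Z2] provides a finite union that covers a neighbourhood of all the
    cluster points of the first tail but misses [r]; by compactness it covers the
    points of [Z2] in the closure of some [Z1 `\` word_union e1 s] that [M0] can
    see. But [r] is a point of that kind which it misses, and because [M0] is
    closed off, [M0] contains such a point as well. *)
Lemma omega_closed_closure_sub Z1 Z2 e1 e2 :
  traced_separation Z1 e1 -> traced_separation Z2 e2 ->
  omega_closed (Z1 `|` Z2) -> closure Z1 `<=` Z1 `|` Z2.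
Proof.
move=> h1 h2 hS w Z1w; apply: contrapT => nSw; set S := Z1 `|` Z2.
(* [M0] reflects the existence of points of [Z2] that lie in the closure of a
   countable part of [Z1] outside of a word. *)
have [M0 [cM0 M0S hM0]] : exists M0, [/\ countable M0, M0 `<=` S &
    forall s t, word_in M0 s -> word_in M0 t -> forall r D, Z2 r -> ~ word_union e2 t r ->
    countable D -> D `<=` Z1 `\` word_union e1 s -> closure D r ->
    exists r' D', [/\ M0 r' /\ Z2 r', ~ word_union e2 t r', D' `<=` M0,
      D' `<=` Z1 `\` word_union e1 s & closure D' r']].
  have /choice[Op hOp] : forall st : seq (T * nat) * seq (T * nat), exists A,
      [/\ countable A, A `<=` S & forall r D, Z2 r -> ~ word_union e2 st.2 r ->
      countable D -> D `<=` Z1 `\` word_union e1 st.1 -> closure D r ->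
      exists r' D', [/\ A r' /\ Z2 r', ~ word_union e2 st.2 r', D' `<=` A,
      D' `<=` Z1 `\` word_union e1 st.1 & closure D' r']].
    move=> [s t] /=.
    have [[r [D [Z2r tr cD DZ Dr]]]|no] := pselect (exists r D,
      [/\ Z2 r, ~ word_union e2 t r, countable D, D `<=` Z1 `\` word_union e1 s & closure D r]).
      exists ([set r] `|` D); split.
      - by apply: countable_setU => //; exact: countable1.
      - by move=> x [->|/DZ[]]; [right|left].
      - by move=> _ _ _ _ _ _ _; exists r, D; split;
          [by split=> //; left | by [] | by move=> x; right | by [] | by []].
    exists set0; split; [exact: countable0|by []|].
    by move=> r D *; exfalso; apply: no; exists r, D.
  have [||||M [cM _ MS hM]] := @closing_off T S (fun s t => Op (s, t)) set0.
  - by move=> s t; have [] := hOp (s, t).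
  - by move=> s t; have [] := hOp (s, t).
  - exact: countable0.
  - by [].
  exists M; split=> // s t os ot r D Z2r tr cD DZ Dr.
  have [_ _ /(_ r D Z2r tr cD DZ Dr)[r' [D' [[Ar Zr] tr' DA DZ' Dr']]]] := hOp (s, t).
  by exists r', D'; split=> // [|x /DA]; [split=> //; exact: (hM s t) | exact: (hM s t)].
have K0S : closure M0 `<=` S by exact: hS.
have [V [ oV Vw cV]] : exists V, [/\ open V, V w & closure V `<=` ~` closure M0].
  apply: shrink_nbhs => //; first by apply: closed_openC; exact: closed_closure.
  by move=> /K0S.
(* [M1] only has to make the tail towards [q] within [V] proper. *)
have [M1 [cM1 M01 M1S hM1]] : exists M1, [/\ countable M1, M0 `<=` M1, M1 `<=` S &
    forall s, word_in M1 s -> (Z1 `&` V) `\` word_union e1 s !=set0 ->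
    (M1 `&` (Z1 `&` V)) `\` word_union e1 s !=set0].
  have /choice[Op hOp] : forall s : seq (T * nat), exists A,
      [/\ countable A, A `<=` S & (Z1 `&` V) `\` word_union e1 s !=set0 ->
      (A `&` (Z1 `&` V)) `\` word_union e1 s !=set0].
    move=> s; have [[x [[Zx Vx] nx]]|no] := pselect ((Z1 `&` V) `\` word_union e1 s !=set0).
      exists [set x]; split; first exact: countable1.
        by move=> _ ->; left.
      by move=> _; exists x.
    by exists set0; split; [exact: countable0| |].
  have [||||M [cM M0M MS hM]] := @closing_off T S (fun s _ => Op s) M0.
  - by move=> s _; have [] := hOp s.
  - by move=> s _; have [] := hOp s.
  - by [].
  - by [].
  exists M; split=> // s os ne.
  have [_ _ /(_ ne)[x [[Ax ZVx] nx]]] := hOp s.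
  by exists x; split => //; split => //; exact: (hM s [::]).
have K1S : closure M1 `<=` S by exact: hS.
have [q Z1q [Vq nK1q]] : exists2 q, Z1 q & (V `&` ~` closure M1) q.
  apply: closure_meets Z1w _ _.
    by apply: openI => //; apply: closed_openC; exact: closed_closure.
  by split=> // /K1S.
have tailM M X x : cluster (tail e1 M X q) x -> closure M x.
  move=> Cx; apply: closure_of_open => O oO Ox.
  have [p//|[p]//|y [[My _] _] Oy] := @tail_cluster_meets e1 M X q x [::] O _ _ Cx oO Ox.
  by exists y.
have [r Cr] : exists r, cluster (tail e1 M1 (Z1 `&` V) q) r.
  have FF := tail_filter e1 M1 (Z1 `&` V) q.
  have PF : ProperFilter (tail e1 M1 (Z1 `&` V) q).
    apply: filter_from_proper => // s [ os sq]; apply: (hM1 s os).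
    by exists q.
  have [r [_ Cr]] := @cT _ PF filterT.
  by exists r.
have Z2r : Z2 r.
  have [Z1r|//] : S r by apply: K1S; exact: tailM Cr.
  exfalso; apply: (tail_cluster_disjoint h1 _ Z1q Z1r _ Cr); first by move=> x [].
  by move=> rq; apply: nK1q; rewrite -rq; exact: tailM Cr.
have K0r : ~ closure M0 r.
  apply: cV; apply: closure_of_open => O oO Or.
  have [p//|[p]//|y [[_ [_ Vy]] _] Oy] :=
    @tail_cluster_meets e1 M1 (Z1 `&` V) q r [::] O _ _ Cr oO Or.
  by exists y.
set D0 := cluster (tail e1 M0 Z1 q).
have D0Z2 : D0 `<=` Z2.
  move=> z Dz; have [Z1z|//] : S z by apply: K0S; exact: tailM Dz.
  exfalso; apply: (tail_cluster_disjoint h1 _ Z1q Z1z _ Dz) => // zq.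
  by apply: nK1q; rewrite -zq; apply: (closureS M01); apply: tailM Dz.
have cD0 : compact D0.
  apply: closed_compactT => //; rewrite /D0 clusterE.
  by apply: closed_bigI => A _; exact: closed_closure.
have [|O [P [ oO D0O tP OP nPr]]] := compact_traced hT cT h2 cD0 D0Z2 Z2r.
  by move=> /tailM.
have [s [ os sq] sO] := cluster_sub_open cT (tail_filter e1 M0 Z1 q) oO D0O.
have [t [ ot tP' Pt]] := tP M0.
have [|||||r' [D' [[M0r' Z2r'] ntr' D'M D'Z Dr']]] :=
  hM0 s t os ot r ((M1 `&` (Z1 `&` V)) `\` word_union e1 s).
- by [].
- by move=> /tP'.
- by apply: countable_subset cM1 => x [[]].
- by move=> x [[_ []]].
- apply: closure_of_open => W oW Wr; apply: tail_cluster_meets Cr oW Wr => //.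
  exact: word_inS os.
apply: ntr'; apply: Pt; split=> //; split=> //; apply: OP; split => //.
apply: (closureS _ Dr') => x D'x; apply: sO.
by have [Z1x nsx] := D'Z _ D'x; split => //; split => //; exact: D'M.
Qed.

(** With [Z2] empty this says that a space with a point-countable p-metabase in
    which countable sets have compact closures is compact; for two sets it yields
    the countable tightness of the compact spaces that they cover. *)
Theorem traced_omega_closed Z1 Z2 e1 e2 :
  traced_separation Z1 e1 -> traced_separation Z2 e2 ->
  omega_closed (Z1 `|` Z2) -> closed (Z1 `|` Z2).
Proof.
move=> h1 h2 hS x; rewrite closureU => -[].
  exact: (omega_closed_closure_sub h1 h2).
by rewrite setUC; apply: (omega_closed_closure_sub h2 h1); rewrite setUC.
Qed.

Definition tight_at X w := forall Y, Y `<=` X -> closure Y w ->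
  exists D, [/\ countable D, D `<=` Y & closure D w].

(** The set of limits of countable subsets of [Y] contains the closures of its
    countable subsets, hence is closed by [traced_omega_closed]. *)
Lemma traced_tight Z1 Z2 e1 e2 w :
  traced_separation Z1 e1 -> traced_separation Z2 e2 ->
  closed (Z1 `|` Z2) -> tight_at (Z1 `|` Z2) w.
Proof.
move=> h1 h2 clZ Y YZ Yw.
pose S := [set x | exists D, [/\ countable D, D `<=` Y & closure D x]].
have SZ : S `<=` Z1 `|` Z2.
  move=> x [D [_ DY Dx]]; apply: clZ; apply: closureS Dx; exact: subset_trans YZ.
have ES : (S `&` Z1) `|` (S `&` Z2) = S.
  by rewrite -setIUr; apply/setIidPl.
have YS : Y `<=` S.
  move=> y Yy; exists [set y]; split; [exact: countable1|by move=> _ ->|].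
  exact: subset_closure.
have : closed ((S `&` Z1) `|` (S `&` Z2)).
  apply: (@traced_omega_closed _ _ e1 e2).
  - by apply: traced_separationS h1 => x [].
  - by apply: traced_separationS h2 => x [].
  rewrite ES => D cD DS x Dx.
  have /choice[E hE] : forall d : T, exists E, D d ->
      [/\ countable E, E `<=` Y & closure E d].
    move=> d; have [/DS[E hE]|nD] := pselect (D d); last by exists set0.
    by exists E.
  exists (\bigcup_(d in D) E d); split.
  - by apply: bigcup_countable => // d /hE[].
  - by move=> y [d /hE[_ + _]]; exact.
  - apply: closure_of_open => O oO Ox.
    have [d Dd Od] := closure_meets Dx oO Ox.
    have [_ _ Ed] := hE d Dd; have [y Ey Oy] := closure_meets Ed oO Od.
    by exists y => //; exists d.
rewrite ES => clS; apply: (clS w); exact: closureS Yw.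
Qed.

(** Close off a countable [M] such that whenever [z] is in the closure of
    [Z `\` word_union e s] for a word [s] over [M], some points of [M] witness
    it. For the other words [s] keep a neighbourhood of [z] covered by [s]. If [x]
    belongs to all of these, then a traced [P] that covers a neighbourhood of [z]
    but not [x] would have a trace on [M] of neither kind. *)
Lemma traced_Gdelta Z e z : traced_separation Z e -> Z z -> tight_at Z z ->
  exists U : nat -> set T, (forall n, open (U n) /\ U n z) /\
    forall x, Z x -> (forall n, U n x) -> x = z.
Proof.
move=> hZ Zz tz.
have /choice[Op hOp] : forall s : seq (T * nat), exists D,
    [/\ countable D, D `<=` Z `\` word_union e s &
    closure (Z `\` word_union e s) z -> closure D z].
  move=> s; have [h|h] := pselect (closure (Z `\` word_union e s) z).
    by have [|D [cD DZ Dz]] := tz _ _ h; [move=> x [] | exists D].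
  by exists set0; split; [exact: countable0| |].
have [||||M [cM _ MZ hM]] := @closing_off T Z (fun s _ => Op s) set0.
- by move=> s _; have [] := hOp s.
- by move=> s _ x; have [_ DZ _ /DZ[]] := hOp s.
- exact: countable0.
- by [].
have /choice[V hV] : forall s : seq (T * nat), exists V, [/\ open V, V z &
    ~ closure (Z `\` word_union e s) z -> V `&` Z `<=` word_union e s].
  move=> s; have [h|h] := pselect (closure (Z `\` word_union e s) z).
    by exists setT; split=> //; exact: openT.
  exists (~` closure (Z `\` word_union e s)); split=> //.
    by apply: closed_openC; exact: closed_closure.
  move=> _ x [nx Zx]; apply: contrapT => sx; apply: nx; exact: subset_closure.
have /countable_injP[f fI] := countable_word_in cM.
pose U n := if pselect (exists s, word_in M s /\ f s = n) is left h
  then V (projT1 (cid h)) else setT.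
have UV s : word_in M s -> U (f s) = V s.
  move=> os; rewrite /U; case: pselect => [h|]; last by move=> h; exfalso; apply: h; exists s.
  case: (cid h) => t /= [ ot ft]; congr V.
  by apply: fI => //; exact/mem_set.
exists U; split=> [n|x Zx Ux].
  rewrite /U; case: pselect => [h|_]; last by split=> //; exact: openT.
  by have [] := hV (projT1 (cid h)).
apply: contrapT => xz.
have [ O [P [ oO Oz tP OP nPx]]] := hZ z x Zz Zx (fun h => xz (esym h)).
have [s [ os sP Ps]] := tP M.
have [ oV Vz Vs] := hV s; have [cD DZ Dz] := hOp s.
have [h|h] := pselect (closure (Z `\` word_union e s) z); last first.
  by apply: nPx; apply: sP; apply: Vs => //; split=> //; rewrite -UV.
have [d Dd Od] := closure_meets (Dz h) oO Oz.
have [Zd nd] := DZ d Dd; apply: nd; apply: Ps; split=> //; split; first exact: OP.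
exact: (hM s [::]).
Qed.

End Tightness.

(** * Countable networks *)

(** The members of the network are arbitrary sets, not subsets of [Z]; this
    makes unions and subspaces immediate. *)
Definition countable_network {T : topologicalType} (Z : set T) :=
  exists N : nat -> set T, forall x, Z x -> forall O, open O -> O x ->
    exists n, N n x /\ N n `<=` O.

Section Networks.
Context {T : topologicalType} (hT : hausdorff_space T) (cT : compact [set: T]).
Implicit Types (x y z w q : T) (M X Z : set T) (e : T -> nat -> set T).

Lemma countable_networkS Z Z' : Z' `<=` Z -> countable_network Z ->
  countable_network Z'.
Proof. by move=> h [N hN]; exists N => x /h; exact: hN. Qed.

Lemma countable_network_bigcup (Z : nat -> set T) :
  (forall n, countable_network (Z n)) -> countable_network (\bigcup_n Z n).
Proof.
move=> /choice[N hN].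
exists (fun k => if unpickle k is Some (m, n) then N m n else set0).
move=> x [m _ Zx] O oO Ox; have [n [Nx NO]] := hN m x Zx O oO Ox.
by exists (pickle (m, n)); rewrite pickleK.
Qed.

Lemma countable_networkU Z Z' : countable_network Z -> countable_network Z' ->
  countable_network (Z `|` Z').
Proof.
move=> h h'; apply: (@countable_networkS (\bigcup_n (if n is 0 then Z else Z'))).
  by move=> x [Zx|Zx]; [exists 0 | exists 1].
by apply: countable_network_bigcup => -[].
Qed.

(** The hypotheses say that the countable cover [C] of [Z] is a network modulo
    the compact sets [K x]; this is a Lindelof Sigma-space. A countable closed off
    [M] is dense in a strong sense (it is dense in the complement of every word
    over [M]), so that the words over [M] alone already separate points, and the
    sets [C n `\` word_union e s] form a network: words cover the part of [K x]
    outside of a given neighbourhood of [x]. *)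
Lemma traced_network Z e (C : nat -> set T) (K : T -> set T) :
  traced_separation Z e ->
  (forall x, Z x -> compact (K x) /\ K x `<=` Z) ->
  (forall x, Z x -> forall O, open O -> K x `<=` O ->
    exists n, C n x /\ C n `&` Z `<=` O) ->
  countable_network Z.
Proof.
move=> hZ hK hC.
have /choice[Op hOp] : forall s : seq (T * nat), exists D,
    [/\ countable D, D `<=` Z & forall n x, C n x -> Z x -> ~ word_union e s x ->
    exists2 d, D d & C n d /\ ~ word_union e s d].
  move=> s.
  have /choice[D hD] : forall n, exists D, [/\ countable D, D `<=` Z & forall x, C n x ->
      Z x -> ~ word_union e s x -> exists2 d, D d & C n d /\ ~ word_union e s d].
    move=> n; have [[x [Cx Zx nx]]|no] := pselect (exists x, [/\ C n x, Z x & ~ word_union e s x]).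
      exists [set x]; split; [exact: countable1|by move=> _ ->|].
      by move=> _ _ _ _; exists x.
    exists set0; split; [exact: countable0|by []|].
    by move=> x *; exfalso; apply: no; exists x.
  exists (\bigcup_n D n); split.
  - by apply: bigcup_countable => // n _; have [] := hD n.
  - by move=> x [n _]; have [_ + _] := hD n; exact.
  - move=> n x Cx Zx nx; have [_ _ /(_ x Cx Zx nx)[d Dd hd]] := hD n.
    by exists d => //; exists n.
have [||||M [cM _ MZ hM]] := @closing_off T Z (fun s _ => Op s) set0.
- by move=> s _; have [] := hOp s.
- by move=> s _; have [] := hOp s.
- exact: countable0.
- by [].
(* [M] is dense in the complement of every word over it: cover the part of [K x]
   outside of [O] by a traced set that misses [x], and enlarge [s] by its trace. *)
have dense_rest s O x : word_in M s -> Z x -> open O -> O x -> ~ word_union e s x ->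
    exists m, [/\ M m, Z m, O m & ~ word_union e s m].
  move=> os Zx oO Ox nsx; have [cK KZ] := hK x Zx.
  have cKO : compact (K x `\` O).
    by apply: compact_closedI => //; exact: open_closedC.
  have [||O' [P [ oO' KO' tP OP nPx]]] := compact_traced hT cT hZ cKO _ Zx.
  - by move=> y [/KZ].
  - by move=> [].
  have [t [ ot tP' Pt]] := tP M.
  have [||n [Cnx CO]] := hC x Zx (O `|` O'); first exact: openU.
    by move=> y Ky; have [Oy|nOy] := pselect (O y); [left|right; exact: KO'].
  have [_ _ /(_ n x Cnx Zx)[|m Dm [Cm]]] := hOp (s ++ t).
    by rewrite word_union_cat => -[//|/tP'].
  have Mm : M m by apply: (hM (s ++ t) [::]) => //; exact: word_in_cat.
  rewrite word_union_cat => /not_orP[nsm ntm]; exists m; split=> //; first exact: MZ.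
  have [|//|O'm] := CO m; first by split => //; exact: MZ.
  exfalso; apply: ntm; apply: Pt; split; last exact: MZ.
  by split=> //; apply: OP; split; [exact: subset_closure | exact: MZ].
(* A neighbourhood covered by a traced set is already covered by the trace of
   this set on [M], by density. *)
have M_separates x y : Z x -> Z y -> x <> y -> exists O s,
    [/\ open O, O x, word_in M s, O `&` Z `<=` word_union e s & ~ word_union e s y].
  move=> Zx Zy xy; have [ O [P [ oO Ox tP OP nPy]]] := hZ x y Zx Zy xy.
  have [s [ os sP Ps]] := tP M; exists O, s; split=> //; last by move=> /sP.
  move=> z [Oz Zz]; apply: contrapT => nsz.
  have [m [Mm Zm Om]] := dense_rest s O z os Zz oO Oz nsz; apply.
  by apply: Ps; split=> //; split=> //; exact: OP.
have [N hN] : exists N : nat -> set T, forall n s, word_in M s -> exists k,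
    N k = (C n `&` Z) `\` word_union e s.
  have /countable_injP[f fI] := countable_word_in cM.
  pose N k := [set x | exists n s, [/\ word_in M s, k = pickle (n, f s) &
    ((C n `&` Z) `\` word_union e s) x]].
  exists N => n s os; exists (pickle (n, f s)); apply/seteqP; split=> x.
    move=> [m [t [ ot /(pcan_inj pickleK)[-> /fI st]]]].
    by rewrite st //; exact/mem_set.
  by move=> hx; exists n, s.
exists N => x Zx O oO Ox; have [cK KZ] := hK x Zx.
have cKO : compact (K x `\` O).
  by apply: compact_closedI => //; exact: open_closedC.
pose Phi := [set V : set T | exists s, [/\ word_in M s, V `&` Z `<=` word_union e s & ~ word_union e s x]].
have [||y [Ky nOy]|V [ oV KV [s [ os Vs nsx]]]] := @compact_local_to_global T _ Phi cKO.
- by exists [::]; split => [p//|? []//|[p]].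
- move=> U V _ _ [s [ os Us nsx]] [t [ ot Vt ntx]]; exists (s ++ t); split.
  + exact: word_in_cat.
  + by rewrite word_union_cat setIUl; exact: setUSS.
  + by rewrite word_union_cat => -[].
- have [|W [s [ oW Wy os Ws nsx]]] := M_separates y x (KZ _ Ky) Zx.
    by move=> yx; apply: nOy; rewrite yx.
  by exists W; split => //; exists s.
have [||n [Cnx CO]] := hC x Zx (O `|` V); first exact: openU.
  by move=> y Ky; have [Oy|nOy] := pselect (O y); [left|right; exact: KV].
have [k Nk] := hN n s os; exists k; rewrite Nk; split=> // y [[Cy Zy] nsy].
by have [|//|Vy] := CO y; [split | exfalso; apply: nsy; apply: Vs].
Qed.

Lemma compact_traced_network Z e : traced_separation Z e -> compact Z ->
  countable_network Z.
Proof.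
move=> hZ cZ; apply: (@traced_network Z e (fun _ => setT) (fun _ => Z)) => //.
  by move=> x _; split.
by move=> x Zx O oO ZO; exists 0; split=> // y [_ /ZO].
Qed.

End Networks.

(** * From p-metabases to traced separations *)

Lemma set_val_embedding (X : topologicalType) (A : set X) :
  topological_embedding (set_val : A -> X).
Proof.
split.
- exact: val_inj.
- by move=> x; exact: initial_continuous.
- move=> _ [V oV <-]; exists V => //; apply/seteqP; split.
    by move=> x [u Vu ux]; rewrite -ux; split=> //; exists u.
  by move=> x [Vx [u _ ux]]; exists u => //=; rewrite /= ux.
Qed.

Lemma comp_embedding (X Y Z : topologicalType) (f : X -> Y) (g : Y -> Z) :
  topological_embedding f -> topological_embedding g ->
  topological_embedding (g \o f).
Proof.
move=> [fI fC fO] [gI gC gO]; split.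
- exact: inj_comp.
- by move=> x; apply: continuous_comp; [exact: fC | exact: gC].
- move=> U /fO[V oV fU]; have [W oW gV] := gO V oV; exists W => //.
  rewrite -image_comp fU; apply/seteqP; split.
    move=> z [y [Vy [x _ xy]] <-]; rewrite -{}xy in Vy *; split; last by exists x.
    have : (g @` V) (g (f x)) by exists (f x).
    by rewrite gV => -[].
  move=> z [Wz [x _ xz]]; rewrite -{}xz in Wz *; exists (f x) => //; split; last by exists x.
  have : (W `&` range g) (g (f x)) by split=> //; exists (f x).
  by rewrite -gV => -[y Vy /gI <-].
Qed.

(** The letter [(f m, k)] names the member [B] through [m] with number [k] in a
    fixed injective numbering [phi m] of the countably many members through [m].
    As [phi m] is injective, the union in the definition of [e] has at most one
    nonempty term. *)
Lemma p_metabase_traced (X T : topologicalType) (f : X -> T) :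
  topological_embedding f -> has_point_countable_p_metabase X ->
  exists e, traced_separation (range f) e.
Proof.
move=> [fI _ fO] [A pA cA].
have /choice[phi phiI] : forall m : X, exists phi : set X -> nat,
    {in [set B | A B /\ B m] &, injective phi}.
  by move=> m; apply/countable_injP; exact: cA.
pose e t k := [set z | exists m B u,
  [/\ f m = t, A B /\ B m, phi m B = k, B u & f u = z]].
have t1 B : A B -> traced (range f) e (f @` B).
  move=> AB M; have [[m [Mm Bm]]|no] := pselect (exists m, M (f m) /\ B m).
    exists [:: (f m, phi m B)]; split.
    - by move=> p; rewrite inE => /eqP ->.
    - move=> z [p]; rewrite inE => /eqP -> /= [m' [B' [u [/fI ->]]]] AB' pB' B'u uz.
      exists u => //; suff <- : B' = B by [].
      by apply: phiI pB'; apply/mem_set.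
    - move=> z [[[u Bu <-] _] _]; exists (f m, phi m B); first exact: mem_head.
      by exists m, B, u.
  exists [::]; split=> // [z []//|z [[[u Bu <-] Mu] _]]; exfalso; apply: no.
  by exists u.
have tF (l : seq (set X)) : (forall B, B \in l -> A B) ->
    traced (range f) e (f @` [set x | exists2 B, B \in l & B x]).
  elim: l => [_|B l IH hl].
    suff -> : f @` [set x | exists2 B, B \in [::] & B x] = set0 by exact: traced0.
    by apply/seteqP; split=> // z [u []].
  have -> : f @` [set x | exists2 B', B' \in B :: l & B' x] =
      f @` B `|` f @` [set x | exists2 B', B' \in l & B' x].
    rewrite -image_setU; congr (f @` _); apply/seteqP; split=> x.
      by move=> [B']; rewrite inE => /orP[/eqP ->|hB']; [left|right; exists B'].
    move=> [Bx|[B' hB' B'x]]; first by exists B => //; exact: mem_head.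
    by exists B' => //; rewrite inE hB' orbT.
  apply: tracedU; first by apply: t1; apply: hl; exact: mem_head.
  by apply: IH => B' hB'; apply: hl; rewrite inE hB' orbT.
exists e => _ _ [x _ <-] [y _ <-] fxy.
have [F [/finite_seqP[l Fl] FA intF Fy]] : exists F : set (set X),
  [/\ finite_set F, F `<=` A, (\bigcup_(B in F) B)° x
    & \bigcup_(B in F) B `<=` ~` [set y]] by apply: pA => xy; apply: fxy; rewrite xy.
have EF : \bigcup_(B in F) B = [set x | exists2 B, B \in l & B x].
  by rewrite Fl; apply/seteqP; split=> z [B hB Bz]; exists B.
have [ O oO hO] := fO _ (open_interior (\bigcup_(B in F) B)).
exists O, (f @` (\bigcup_(B in F) B)); split=> //.
- have : (f @` (\bigcup_(B in F) B)°) (f x) by exists x.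
  by rewrite hO => -[].
- by rewrite EF; apply: tF => B hB; apply: FA; rewrite Fl.
- by rewrite -hO; apply: image_subset; exact: interior_subset.
- by move=> [u /Fy uy /fI]; exact: uy.
Qed.

Lemma locally_p_metabase_traced (T : topologicalType) (Y : set T) :
  has_locally_point_countable_p_metabase Y -> locally_traced Y.
Proof.
move=> hY y Yy; have [U [ oU Uy] hU] := hY (exist _ y (mem_set Yy)).
have [e he] := p_metabase_traced (comp_embedding (@set_val_embedding _ U)
  (@set_val_embedding _ Y)) hU.
have [ O oO UO] := oU; exists O, e; split=> //.
  by move: Uy; rewrite -UO.
apply: traced_separationS he => x [Ox Yx].
have Ux : U (exist _ x (mem_set Yx)) by rewrite -UO.
by exists (exist (fun u => u \in U) _ (mem_set Ux)).
Qed.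

(** * Metrization of compact spaces with a countable network *)

Section Metrization.
Context {R : realType} {T : topologicalType}.
Context (hT : hausdorff_space T) (cT : compact [set: T]).
Local Open Scope ring_scope.

(** For each pair of members of the network that can be separated by a
    continuous function, pick one such function. *)
Lemma countable_separating_functions : countable_network [set: T] ->
  exists f : nat -> T -> R, [/\ forall n, continuous (f n),
    forall n x, 0 <= f n x <= 1 & forall x y, (forall n, f n x = f n y) -> x = y].
Proof.
move=> [N hN].
have /(normal_separatorP (R := R)) nS := compact_normal hT cT.
have /choice[f hf] : forall k : nat * nat, exists f : T -> R,
    [/\ continuous f, forall x, 0 <= f x <= 1 &
     (exists g : T -> R, [/\ continuous g, (forall x, 0 <= g x <= 1),
        (forall x, N k.1 x -> g x = 0) & (forall x, N k.2 x -> g x = 1)]) ->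
     (forall x, N k.1 x -> f x = 0) /\ (forall x, N k.2 x -> f x = 1)].
  move=> k; have [[g [gc g01 g0 g1]]|no] := pselect (exists g : T -> R,
     [/\ continuous g, (forall x, 0 <= g x <= 1),
     (forall x, N k.1 x -> g x = 0) & (forall x, N k.2 x -> g x = 1)]).
    by exists g.
  exists (fun _ => 0); split=> //; last by move=> _; rewrite lexx ler01.
  by move=> x; exact: cvg_cst.
exists (fun n => if unpickle n is Some k then f k else (fun _ => 0)); split.
- move=> n; case: (unpickle n) => [k|]; first by have [] := hf k.
  by move=> x; exact: cvg_cst.
- move=> n x; case: (unpickle n) => [k|]; first by have [_ + _] := hf k.
  by rewrite lexx ler01.
- move=> x y hxy; apply: contrapT => xy.
  have [U [V [ oU oV Ux Vy UV]]] := open_separation hT xy.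
  have [U' [ oU' Ux' cU']] := shrink_nbhs hT cT oU Ux.
  have [V' [ oV' Vy' cV']] := shrink_nbhs hT cT oV Vy.
  have [n [Nx NU]] := hN x I U' oU' Ux'.
  have [m [Ny NV]] := hN y I V' oV' Vy'.
  have [_ _ []] := hf (n, m); last first.
    move=> /(_ x Nx) f0 /(_ y Ny) f1; have := hxy (pickle (n, m)).
    by rewrite pickleK f0 f1 => /eqP; rewrite eq_sym oner_eq0.
  have : uniform_separator (closure U') (closure V').
    apply: nS; [exact: closed_closure|exact: closed_closure|].
    by apply/seteqP; split=> // z [/cU' Uz /cV' Vz]; rewrite -UV.
  move=> /(@uniform_separatorP T R)[g [gc g01 g0 g1]]; exists g; split=> //.
  + by move=> z; have /g01 := imageT g z; rewrite /= in_itv.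
  + move=> z /NU U'z; have : (g @` closure U') (g z).
      by exists z => //; exact: subset_closure.
    by move/g0.
  + move=> z /NV V'z; have : (g @` closure V') (g z).
      by exists z => //; exact: subset_closure.
    by move/g1.
Qed.

(** The metric is the supremum of the [`|f k x - f k y| / k.+1]: the weights
    make it continuous, and a continuous metric on a compact space induces the
    topology. *)
Lemma countable_network_metrizable : countable_network [set: T] ->
  metrizable R T.
Proof.
move=> /countable_separating_functions[f [fC f01 fI]].
pose D x y := range (fun k : nat => `|f k x - f k y| / k.+1%:R).
pose d x y : R := sup (D x y).
have D0 x y : D x y !=set0 by exists (`|f 0 x - f 0 y| / 1%:R); exists 0%N.
have Dle x y k : `|f k x - f k y| / k.+1%:R <= k.+1%:R^-1.
  rewrite ler_piMl ?invr_ge0// ler_norml.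
  have /andP[? ?] := f01 k x; have /andP[? ?] := f01 k y.
  by apply/andP; split; lra.
have Dub x y : ubound (D x y) 1.
  move=> _ [k _ <-]; apply: (le_trans (Dle x y k)).
  by rewrite invf_le1 ?ltr0n// ler1n.
have dge x y k : `|f k x - f k y| / k.+1%:R <= d x y.
  by apply: ub_le_sup; [exists 1; exact: Dub | exists k].
have dle x y c : (forall k, `|f k x - f k y| / k.+1%:R <= c) -> d x y <= c.
  by move=> h; apply: ge_sup => // _ [k _ <-].
have dM : is_metric d.
  split.
  - by move=> x y; apply: le_trans (dge x y 0%N); rewrite divr_ge0.
  - move=> x y; split=> [dxy|->].
      apply: fI => k; have := dge x y k; rewrite dxy pmulr_lle0 ?invr_gt0//.
      by rewrite normr_le0 subr_eq0 => /eqP.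
    apply/eqP; rewrite eq_le; apply/andP; split.
      by apply: dle => k; rewrite subrr normr0 mul0r.
    by apply: le_trans (dge y y 0%N); rewrite divr_ge0.
  - move=> x y; congr sup; apply/seteqP.
    by split=> _ [k _ <-]; exists k => //; rewrite distrC.
  - move=> x y z; apply: dle => k; apply: le_trans (lerD (dge x y k) (dge y z k)).
    rewrite -mulrDl ler_pM2r ?invr_gt0//; exact: ler_distD.
have [d0 d0E dC dtri] := dM.
have dnear x e : 0 < e -> nbhs x [set z | d x z < e].
  move=> e0; have e20 : 0 < e / 2 by rewrite divr_gt0.
  have [n] := ltr_add_invr e20; rewrite add0r => ne.
  have : nbhs x [set z | forall k : 'I_n.+1, `|f k x - f k z| < e / 2].
    apply: filter_forall => k; exact: (cvgr_dist_lt _ _ (fC k x)).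
  apply: filterS => z hz /=.
  apply: (@le_lt_trans _ _ (e / 2)); last by rewrite ltr_pdivrMr// ltr_pMr ?ltr1n.
  apply: dle => k; have [kn|nk] := ltnP k n.+1.
    apply: le_trans (ltW (hz (Ordinal kn))) => /=.
    by rewrite ler_piMr// invf_le1 ?ltr0n// ler1n.
  apply: (le_trans (Dle x z k)); apply: le_trans (ltW ne).
  by rewrite lef_pV2 ?posrE// ler_nat ltnW.
exists d => // x; apply/seteqP; split=> U; last first.
  by move=> [e e0 eU]; apply: filterS eU _; exact: dnear.
move=> nU.
pose B n := [set z | d x z < n.+1%:R^-1].
have FF : Filter (filter_from [set: nat] B).
  apply: filter_from_filter; first by exists 0%N.
  move=> m n _ _; exists (maxn m n) => // z; rewrite /B /= => dz.
  by split; apply: (lt_le_trans dz); rewrite lef_pV2 ?posrE// ler_nat ltnS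
     (leq_maxl, leq_maxr).
have [|n _ BU] := cluster_sub_open cT FF (@open_interior T U).
  move=> y By; suff <- : x = y by exact: nU.
  apply: contrapT => xy.
  have dxy : 0 < d x y / 2.
    rewrite divr_gt0// lt_neqAle d0 andbT eq_sym; apply/eqP => /d0E; exact: xy.
  have [n] := ltr_add_invr dxy; rewrite add0r => nd.
  have [|z [Bz dz]] := By (B n) _ _ (dnear y _ dxy); first by exists n.
  have := dtri x z y; rewrite leNgt => /negP; apply.
  rewrite [ltRHS](splitr (d x y)); apply: ltrD; last by rewrite dC.
  exact: lt_trans Bz nd.
exists n.+1%:R^-1; first by rewrite /= invr_gt0.
by move=> z /BU; exact: interior_subset.
Qed.

End Metrization.

Lemma metrizable_embedding (R : realType) (X T : topologicalType) (f : X -> T) :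
  topological_embedding f -> metrizable R T -> metrizable R X.
Proof.
move=> [fI fC fO] [d [d0 dE dC dT] hd]; exists (fun x y => d (f x) (f y)).
  split=> // x y; split=> [/dE/fI//|->]; exact/dE.
move=> x; apply/seteqP; split=> U; last first.
  move=> [e e0 eU]; apply: filterS eU _.
  have : nbhs (f x) [set z | (d (f x) z < e)%R] by rewrite hd; exists e.
  exact: fC.
rewrite nbhsE => -[W [ oW Wx] WU]; have [V oV fW] := fO W oW.
have [Vx _] : (V `&` range f) (f x) by rewrite -fW; exists x.
have : nbhs (f x) V by exact: open_nbhs_nbhs.
rewrite hd => -[e e0 eV]; exists e => // z /= dz; apply: WU.
have : (V `&` range f) (f z) by split; [exact: eV | exists z].
by rewrite -fW => -[u Wu /fI <-].
Qed.

Lemma countable_network_separable (X T : topologicalType) (f : X -> T) :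
  topological_embedding f -> countable_network [set: T] -> separable X.
Proof.
move=> [fI fC fO] [N hN].
pose S n := [set x | N n (f x)].
have /choice[D hD] : forall n, exists D : set X, countable D /\
    (S n !=set0 -> D `&` S n !=set0).
  move=> n; have [[x Sx]|no] := pselect (S n !=set0).
    by exists [set x]; split=> [|_]; [exact: countable1 | exists x].
  by exists set0; split=> //; exact: countable0.
exists (\bigcup_n D n).
  by apply: bigcup_countable => // n _; have [] := hD n.
move=> U [x Ux] oU; have [V oV fU] := fO U oU.
have [Vx _] : (V `&` range f) (f x) by rewrite -fU; exists x.
have [n [Nx NV]] := hN (f x) I V oV Vx.
have [|y [Dy Sy]] := (hD n).2; first by exists x.
exists y; split; last by exists n.
have : (V `&` range f) (f y) by split; [exact: NV | exists y].
by rewrite -fU => -[u Uu /fI <-].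
Qed.

(** * Topological groups *)

Section GroupTools.
Context {G : topologicalGroupType}.
Implicit Types (a b g h k x y : G) (U V W : set G).

Lemma mulg_open W x y : open W -> W (x * y)%g -> exists U V,
  [/\ open U, open V, U x, V y & forall a b, U a -> V b -> W (a * b)%g].
Proof.
move=> oW Wxy; have := @mulg_continuous G (x, y) W (open_nbhs_nbhs (conj oW Wxy)).
move=> [[A B] /= []]; rewrite !nbhsE => -[U [ oU Ux] UA] [V [ oV Vy] VB] h.
by exists U, V; split=> // a b Ua Vb; apply: (h (a, b)); split; [exact: UA|exact: VB].
Qed.

Lemma lshift_continuous g : continuous (fun x : G => (g * x)%g).
Proof.
move=> x; apply: (@continuous_comp _ _ _ (fun x => (g, x)) (fun xy : G * G => (xy.1 * xy.2)%g)).
  by apply: cvg_pair => //; exact: cvg_cst.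
exact: mulg_continuous.
Qed.

Lemma open_lshift g W : open W -> open [set x | W (g * x)%g].
Proof.
by move=> oW; apply: (@open_comp _ _ (fun x : G => (g * x)%g)) => // x _;
  exact: lshift_continuous.
Qed.

Lemma open_inv W : open W -> open [set x : G | W (x^-1)%g].
Proof.
by move=> oW; apply: (@open_comp _ _ (fun x : G => (x^-1)%g)) => // x _;
  exact: invg_continuous.
Qed.

Lemma open_divl W : open W -> W 1%g -> exists V, [/\ open V, V 1%g &
  forall a b, V a -> V b -> W (a^-1 * b)%g].
Proof.
move=> oW W1; have [|U [V [ oU oV U1 V1 h]]] := @mulg_open W 1%g 1%g oW.
  by rewrite mulg1.
exists (V `&` [set x | U (x^-1)%g]); split.
- by apply: openI => //; exact: open_inv.
- by split=> //=; rewrite invg1.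
- by move=> a b [_ Ua] [Vb _]; exact: h.
Qed.

End GroupTools.

(** * Products of points of the compactification with group elements *)

Section Compactification.
Context {G : topologicalGroupType} {K : topologicalType} (i : G -> K).
Context (hK : hausdorff_space K) (cK : compact [set: K]).
Context (iE : topological_embedding i) (iD : dense (range i)).
Local Notation Y := (remainder i).
Implicit Types (a b g h k : G) (x y z c : K).

Lemma i_inj : injective i. Proof. by case: iE. Qed.

Lemma open_preimage (V : set K) : open V -> open [set g | V (i g)].
Proof. by move=> oV; apply: (@open_comp _ _ i) => // x _; case: iE. Qed.

Lemma open_extension (U : set G) : open U ->
  exists V : set K, open V /\ forall g, V (i g) <-> U g.
Proof.
case: iE => iI _ iO /iO[V oV iUV]; exists V; split=> // g; split=> [Vg|Ug].
  have : (V `&` range i) (i g) by split=> //; exists g.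
  by rewrite -iUV => -[u Uu /iI <-].
have : (i @` U) (i g) by exists g.
by rewrite iUV => -[].
Qed.

Lemma dense_meets (V : set K) x : open V -> V x -> exists g, V (i g).
Proof.
move=> oV Vx; have [|z [Vz [g _ gz]]] := @iD V _ oV; first by exists x.
by exists g; rewrite gz.
Qed.

Lemma remainder_or_image x : Y x \/ exists g, x = i g.
Proof.
by have [[g _ <-]|nx] := pselect (range i x); [right; exists g | left].
Qed.

Lemma image_notin_remainder g : ~ Y (i g).
Proof. by apply; exists g. Qed.

(** Left multiplication by a point [c] of the remainder does not make sense, but
    the products [g * h] with [g] tending to [c] have limit points in [K]. They form
    the compact set [limit_product c h] below, which depends upper
    semicontinuously on both arguments. *)
Definition product_set (O : set K) (W : set G) : set K :=
  [set z | exists g h, [/\ O (i g), W h & i (g * h)%g = z]].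

Definition product_filter c h : set_system K :=
  filter_from [set OW : set K * set G | [/\ open OW.1, OW.1 c, open OW.2 & OW.2 h]]
    (fun OW => product_set OW.1 OW.2).

#[local] Instance product_filter_proper c h : ProperFilter (product_filter c h).
Proof.
apply: filter_from_proper; last first.
  move=> [ O W] /= [ oO Oc oW Wh]; have [g Og] := dense_meets oO Oc.
  by exists (i (g * h)%g), g, h.
apply: filter_from_filter.
  by exists (setT, setT); split=> //; exact: openT.
move=> [ O W] [ O' W'] /= [ oO Oc oW Wh] [ oO' Oc' oW' Wh'].
exists (O `&` O', W `&` W'); first by split=> //=; exact: openI.
by move=> z [g [k [[Og Og'] [Wk Wk'] gk]]]; split; exists g, k.
Qed.

Definition limit_product c h := cluster (product_filter c h).

Lemma limit_product_meets c h z (O : set K) (W : set G) (B : set K) : limit_product c h z ->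
  open O -> O c -> open W -> W h -> open B -> B z ->
  exists g k, [/\ O (i g), W k & B (i (g * k)%g)].
Proof.
move=> Cz oO Oc oW Wh oB Bz.
have [|_ [[g [k [Og Wk <-]]] Bgk]] :=
  Cz (product_set O W) B _ (open_nbhs_nbhs (conj oB Bz)); last by exists g, k.
by exists (O, W).
Qed.

Lemma limit_product_neq0 c h : limit_product c h !=set0.
Proof. by have [z [_ Cz]] := @cK _ (product_filter_proper c h) filterT; exists z. Qed.

Lemma limit_product_compact c h : compact (limit_product c h).
Proof.
apply: closed_compactT => //; rewrite /limit_product clusterE.
by apply: closed_bigI => A _; exact: closed_closure.
Qed.

Lemma limit_product_image g h : limit_product (i g) h `<=` [set i (g * h)%g].
Proof.
move=> z Cz; apply: contrapT => /(open_separation hK)[U [V [ oU oV Uz Vgh UV]]].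
have [A [B [ oA oB Ag Bh AB]]] := mulg_open (open_preimage oV) Vgh.
have [A' [ oA' A'E]] := open_extension oA.
have [|a [b [A'a Bb Uab]]] := limit_product_meets Cz oA' _ oB Bh oU Uz; first exact/A'E.
have : (U `&` V) (i (a * b)%g) by split=> //; apply: AB => //; exact/A'E.
by rewrite UV.
Qed.

(** If the products [a * b] tended to [k] in [G] with [b] tending to [h], then
    [a] would tend to [k * h^-1], hence [c] would be in [G]. *)
Lemma limit_product_remainder c h : Y c -> limit_product c h `<=` Y.
Proof.
move=> Yc z Cz [k _ kz]; rewrite -{}kz in Cz.
have [|U [V [ oU oV Uc Vkh UV]]] := @open_separation _ hK c (i (k * h^-1)%g).
  by move=> ch; apply: (@image_notin_remainder (k * h^-1)%g); rewrite -ch.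
have [A [B [ oA oB Ak Bh AB]]] := mulg_open (open_preimage oV) Vkh.
have [A' [ oA' A'E]] := open_extension oA.
have [||a [b [Ua Bb A'ab]]] := limit_product_meets Cz oU Uc (open_inv oB) _ oA' _.
- by [].
- exact/A'E.
have : (U `&` V) (i a).
  split=> //; rewrite -(mulgK b a); apply: AB => //; exact/A'E.
by rewrite UV.
Qed.

Lemma limit_product_usc c h (B : set K) : open B -> limit_product c h `<=` B ->
  exists O W, [/\ open O, O c, open W, W h &
    forall c' h', O c' -> W h' -> limit_product c' h' `<=` B].
Proof.
move=> oB hB; have [V [ oV DV VB]] := shrink_compact hK cK (@limit_product_compact c h) oB hB.
have [[ O W] /= [ oO Oc oW Wh] OWV] := cluster_sub_open cK (product_filter_proper c h) oV DV.
exists O, W; split=> // c' h' Oc' Wh' z Cz; apply: VB.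
apply: closure_of_open => A oA Az.
have [g [k [Og Wk Agk]]] := limit_product_meets Cz oO Oc' oW Wh' oA Az.
by exists (i (g * k)%g) => //; apply: OWV; exists g, k.
Qed.

Context (Yloc : locally_traced Y).

(** If a sequence [C] of points of the remainder accumulates at a point [g0] of the
    group, then the sets [limit_product (C n) h] approximate [g0 * h]; so for
    [h] and [h'] distinct some [n] makes those sets disjoint. An arbitrary
    selection [s n] of [limit_product (C n)] therefore separates enough, and by
    upper semicontinuity the preimages under the [s n] of the traced sets of the
    remainder contain neighbourhoods. The family on the remainder being only
    local, this works on a G-delta neighbourhood of a given point [g]. *)
Lemma traced_separation_transport (C : nat -> K) g0 g : (forall n, Y (C n)) ->
  closure (range C) (i g0) ->
  exists U : nat -> set K, (forall n, open (U n) /\ U n (i g)) /\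
    exists e, traced_separation [set x | range i x /\ forall n, U n x] e.
Proof.
move=> YC Cg0.
have /choice[V hV] : forall n, exists V : set K * (K -> nat -> set K) * set K,
    [/\ open V.2, V.2 (i g), traced_separation (V.1.1 `&` Y) V.1.2 &
     forall h, V.2 (i (g * h)%g) -> limit_product (C n) h `<=` V.1.1 `&` Y].
  move=> n; have [V [e [ oV DV he]]] := compact_locally_traced Yloc
    (@limit_product_compact (C n) 1%g) (limit_product_remainder (YC n)).
  have [ O [W [ oO OC oW W1 OWV]]] := limit_product_usc oV DV.
  have [U [ oU UE]] := open_extension (open_lshift (g^-1)%g oW).
  exists (V, e, U); split=> //=; first by apply/UE; rewrite /= mulVg.
  move=> h /UE /=; rewrite mulKg => Wh z Cz; split; first exact: OWV Cz.
  exact: limit_product_remainder Cz.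
have /choice[s hs] : forall nx : nat * K, exists z, forall h, nx.2 = i h ->
    limit_product (C nx.1) (g^-1 * h)%g z.
  move=> [n x]; case: (remainder_or_image x) => [Yx|[h ->]].
    by exists x => h /= xh; exfalso; apply: (@image_notin_remainder h); rewrite -xh.
  have [z hz] := limit_product_neq0 (C n) (g^-1 * h)%g.
  by exists z => h' /i_inj <-.
pose e t m := if unpickle m is Some (n, k) then
  [set x | (V n).1.2 (s (n, t)) k (s (n, x))] else set0.
exists (fun n => (V n).2); split; first by move=> n; have [] := hV n.
exists e => x y [[h _ <-{x}] Uh] [[h' _ <-{y}] Uh'] hh'.
have hh'0 : i (g0 * (g^-1 * h))%g <> i (g0 * (g^-1 * h'))%g.
  by move=> /i_inj/mulgI/mulgI E; apply: hh'; rewrite E.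
have [U1 [U2 [ oU1 oU2 U1h U2h U12]]] := open_separation hK hh'0.
have [|O1 [W1 [ oO1 O1g oW1 W1h h1]]] := @limit_product_usc (i g0) (g^-1 * h)%g U1 oU1.
  by move=> z /limit_product_image ->.
have [|O2 [W2 [ oO2 O2g oW2 W2h h2]]] := @limit_product_usc (i g0) (g^-1 * h')%g U2 oU2.
  by move=> z /limit_product_image ->.
have [z [n _ nz] [ O1C O2C]] := closure_meets Cg0 (openI oO1 oO2) (conj O1g O2g).
rewrite -{z}nz in O1C O2C.
have [ oUn Ung hVn hUn] := hV n.
set D := limit_product (C n) (g^-1 * h)%g.
have DV : D `<=` (V n).1.1 `&` Y by apply: hUn; rewrite mulVKg; exact: Uh.
have sh' : limit_product (C n) (g^-1 * h')%g (s (n, i h')) by exact: (hs (n, i h')).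
have Vsh' : ((V n).1.1 `&` Y) (s (n, i h')).
  by apply: (hUn (g^-1 * h')%g) => //; rewrite mulVKg; exact: Uh'.
have nD : ~ D (s (n, i h')).
  move=> Ds; have : (U1 `&` U2) (s (n, i h')).
    by split; [exact: h1 Ds | exact: h2 sh'].
  by rewrite U12.
have [ O [P [ oO DO tP OP nP]]] := compact_traced hK cK hVn
  (@limit_product_compact _ _) DV Vsh' nD.
have [ O3 [W [ oO3 O3C oW Wh hW]]] := limit_product_usc oO DO.
have [ O' [ oO' O'E]] := open_extension (open_lshift (g^-1)%g oW).
exists O', [set x | P (s (n, x))]; split=> //.
- exact/O'E.
- move=> M; have [t [ ot tP' Pt]] := tP ((fun x => s (n, x)) @` M).
  have /choice[r hr] : forall y, exists x, ((fun x => s (n, x)) @` M) y ->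
      M x /\ s (n, x) = y.
    move=> y; have [[x Mx xy]|no] := pselect (((fun x => s (n, x)) @` M) y).
      by exists x.
    by exists y.
  exists [seq (r p.1, pickle (n, p.2)) | p <- t]; split.
  + by move=> _ /mapP[p pt ->] /=; have [] := hr _ (ot p pt).
  + move=> x [_ /mapP[p pt ->]] /=; rewrite /e pickleK /= => ex.
    have [_ E] := hr _ (ot p pt); rewrite E in ex.
    by apply: tP'; exists p.
  + move=> x [[Px Mx] [[k _ kx] Ux]].
    have [|p pt ep] := Pt (s (n, x)).
      split; first by split=> //; exists x.
      apply: (hUn (g^-1 * k)%g); first by rewrite mulVKg kx.
      exact: (hs (n, x)).
    exists (r p.1, pickle (n, p.2)); first by apply/mapP; exists p.
    rewrite /e /= pickleK /=; have [_ ->] := hr _ (ot p pt); exact: ep.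
- move=> _ [/[swap] -[[k _ <-] Uk] /O'E /= Wk]; apply: OP.
  have sk : limit_product (C n) (g^-1 * k)%g (s (n, i k)) by exact: (hs (n, i k)).
  split; first by apply: subset_closure; exact: hW sk.
  by apply: (hUn _ _ _ sk); rewrite mulVKg; exact: Uk.
Qed.

End Compactification.

(** * From the separation on the remainder to a countable network *)

Section Remainder.
Context {G : topologicalGroupType} {K : topologicalType} (i : G -> K).
Context (hK : hausdorff_space K) (cK : compact [set: K]).
Context (iE : topological_embedding i) (iD : dense (range i)).
Local Notation Y := (remainder i).
Implicit Types (a b g h k : G) (x y z c : K).

(** An open set missed by the remainder consists of points of [G] and yields a
    compact neighbourhood of one point of [G], which translations move to every
    point. *)
Lemma remainder_dense : ~ locally_compact [set: G] ->
  forall V x, open V -> V x -> exists2 y, Y y & V y.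
Proof.
move=> nlc V x oV Vx; apply: contrapT => noY; apply: nlc.
have VG z : V z -> exists g, z = i g.
  by move=> Vz; case: (remainder_or_image i z) => // Yz; exfalso; apply: noY; exists z.
have [g Vg] := dense_meets iD oV Vx.
have [V' [ oV' V'g cV']] := shrink_nbhs hK cK oV Vg.
pose E := [set h | closure V' (i h)].
have iC : continuous i by case: iE.
have cE : compact E.
  move=> F PF FE.
  have [z [cz Fz]] : closure V' `&` cluster (i @ F) !=set0.
    by apply: closed_compactT => //; exact: closed_closure.
  have [k zk] := VG z (cV' z cz); exists k; split; first by rewrite /E /= -zk.
  move=> A B FA; rewrite nbhsE => -[U [ oU Uk] UB].
  have [W [ oW WE]] := open_extension iE oU.
  have nW : nbhs z W by rewrite zk; apply: open_nbhs_nbhs; split=> //; exact/WE.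
  have FiA : (i @ F) (i @` A) by apply: (@filterS _ F _ A) => // a Aa; exists a.
  have [w [[a Aa aw] Ww]] : (i @` A) `&` W !=set0 by exact: Fz.
  have Ua : U a by apply/WE; rewrite aw.
  by exists a; split=> //; exact: UB.
move=> h _.
pose N := [set k | closure V' (i (g * h^-1 * k)%g)].
have EN : N = (fun k => (h * g^-1 * k)%g) @` E.
  apply/seteqP; split=> k.
    by move=> Nk; exists (g * h^-1 * k)%g => //; rewrite !mulgA mulgVK mulgV mul1g.
  by move=> [k' Ek' <-]; rewrite /N /= !mulgA mulgVK mulgV mul1g.
have cN : compact N.
  rewrite EN; apply: continuous_compact => //; apply: continuous_subspaceT.
  exact: lshift_continuous.
exists N; last split=> //.
- have oN : open [set k : G | V' (i (g * h^-1 * k)%g)].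
    exact: (open_lshift (g * h^-1)%g (open_preimage iE oV')).
  rewrite /within /= nbhsE; exists [set k : G | V' (i (g * h^-1 * k)%g)].
    by split=> //=; rewrite mulgVK.
  by move=> k /= hk _; exact: subset_closure.
- apply: (@closed_comp _ _ (fun k => i (g * h^-1 * k)%g)).
    move=> k _; apply: (@continuous_comp _ _ _ (fun k : G => (g * h^-1 * k)%g) i).
      exact: lshift_continuous.
    exact: iC.
  exact: closed_closure.
Qed.

Context (Yloc : locally_traced Y).
Context (YD : forall V x, open V -> V x -> exists2 y, Y y & V y).

(** Otherwise [traced_omega_closed] makes a closed piece of the remainder compact;
    being dense in an open subset of [K], the remainder would contain it, and [G]
    would not be dense. *)
Lemma remainder_not_omega_closed : ~ omega_closed Y.
Proof.
move=> hY; have [y Yy _] := YD openT (I : [set: K] (i 1%g)).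
have [ O [e [ oO Oy he]]] := Yloc Yy.
have [V [ oV Vy VO]] := shrink_nbhs hK cK oO Oy.
have cl : closed (closure V `&` Y).
  rewrite -[closure V `&` Y]setU0.
  apply: (@traced_omega_closed _ hK cK _ _ e (fun _ _ => set0)).
  - by apply: traced_separationS he => x [/VO].
  - by move=> x y' [].
  - rewrite setU0 => D cD DY x Dx; split.
      by apply: closed_closure; apply: closureS Dx => z /DY[].
    by apply: hY Dx => // z /DY[].
have [g Vg] := dense_meets iD oV Vy.
have [_ []] : (closure V `&` Y) (i g); last by exists g.
apply: cl; apply: closure_of_open => A oA Ag.
have [y' Yy' [Vy' Ay']] := YD (openI oV oA) (conj Vg Ag).
by exists y' => //; split=> //; exact: subset_closure.
Qed.

(** Some countable subset of the remainder accumulates in [G], so that [G] carries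
    traced separations by [traced_separation_transport]. A small closed G-delta set
    [Z] is then covered by two subspaces [Z1] of [G] and [Z2] of [Y], both with a
    traced separation, and is countably tight. By [traced_Gdelta] there is a closed
    G-delta set [Q] of [Z] whose only point in [G] is [g], and for the same reason
    its other points are G-delta points of [K], hence have countable bases in [K].
    Either [g] is isolated in [Q], and has a countable base itself, or it is in
    the closure of a countable set of points with countable bases. *)
Lemma countable_pi_base : exists (PB : set (set K)) g, [/\ countable PB,
  forall P, PB P -> open P /\ P !=set0 &
  forall O, open O -> O (i g) -> exists2 P, PB P & P `<=` O].
Proof.
have [C [YC [g0 Cg0]]] : exists C : nat -> K, (forall n, Y (C n)) /\
    exists g0, closure (range C) (i g0).
  apply: contrapT => no; apply: remainder_not_omega_closed => D cD DY x Dx.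
  case: (remainder_or_image i x) => // -[g xg]; exfalso; apply: no.
  have [d Dd _] := closure_meets Dx openT I.
  have [C [CD DC]] := countable_enum d cD.
  exists C; split; first by move=> n; case: (CD n) => [/DY//|->]; exact: DY.
  by exists g; rewrite -xg; apply: closureS Dx => z /DC[n <-]; exists n.
have [y Yy _] := YD openT (I : [set: K] (i 1%g)).
have [ O0 [e2 [ oO0 O0y he2]]] := Yloc Yy.
have [g O0g] := dense_meets iD oO0 O0y.
have [U [hU [e1 he1]]] := traced_separation_transport hK cK iE iD Yloc g YC Cg0.
have [B [hB hBS BU]] := @nested_nbhs K hK cK (i g) (fun n => U n `&` O0)
  (fun n => conj (openI (hU n).1 oO0) (conj (hU n).2 O0g)).
set Z := \bigcap_n B n; pose Z1 := Z `&` range i; pose Z2 := Z `&` Y.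
have EZ : Z1 `|` Z2 = Z.
  by rewrite -setIUr /remainder setUv setIT.
have ZU x : Z x -> forall n, (U n `&` O0) x.
  by move=> Zx n; apply: BU; apply: subset_closure; exact: Zx.
have h1 : traced_separation Z1 e1.
  by apply: traced_separationS he1 => x [Zx ix]; split=> // n; have [] := ZU x Zx n.
have h2 : traced_separation Z2 e2.
  by apply: traced_separationS he2 => x [Zx ix]; split=> //; have [] := ZU x Zx 0.
have tZ x : tight_at Z x.
  by rewrite -EZ; apply: traced_tight h1 h2 _; rewrite // EZ; exact: nested_closed.
have tS S x : S `<=` Z -> tight_at S x.
  by move=> SZ X XS; apply: tZ; exact: subset_trans SZ.
have Zg : Z (i g) by move=> n _; have [] := hB n.
have [U1 [hU1 U1Z]] : exists U1 : nat -> set K, (forall n, open (U1 n) /\ U1 n (i g)) /\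
    forall x, Z1 x -> (forall n, U1 n x) -> x = i g.
  by apply: (traced_Gdelta h1); [split=> //; exists g | apply: tS => x []].
have [B1 [hB1 B1S B1U]] := @nested_nbhs K hK cK (i g) (fun n => U1 n `&` B n)
  (fun n => conj (openI (hU1 n).1 (hB n).1) (conj (hU1 n).2 (hB n).2)).
set Q := \bigcap_n B1 n.
have QUB x : Q x -> forall n, (U1 n `&` B n) x.
  by move=> Qx n; apply: B1U; apply: subset_closure; exact: Qx.
have QZ : Q `<=` Z by move=> x Qx n _; have [] := QUB x Qx n.
have QG h : Q (i h) -> i h = i g.
  move=> Qh; apply: U1Z => [|n]; last by have [] := QUB _ Qh n.
  by split; [exact: QZ | exists h].
(* The points of [Q] other than [i g] are G-delta points of [K]. *)
have Qbase x : Q x -> x <> i g -> exists N : nat -> set K,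
    (forall n, open (N n) /\ N n x) /\
    forall O, open O -> O x -> exists n, N n `<=` O.
  move=> Qx xg.
  have Yx : Y x by case: (remainder_or_image i x) => // -[h xh]; exfalso; apply: xg; rewrite xh QG// -xh.
  have [U2 [hU2 U2Z]] : exists U2 : nat -> set K, (forall n, open (U2 n) /\ U2 n x) /\
      forall z, Z2 z -> (forall n, U2 n z) -> z = x.
    by apply: (traced_Gdelta h2); [split=> //; exact: QZ | apply: tS => z []].
  have [W [V [ oW _ Wx Vg WV]]] := open_separation hK xg.
  have [N [hN NS NU]] := @nested_nbhs K hK cK x (fun n => U2 n `&` (B1 n `&` W))
    (fun n => conj (openI (hU2 n).1 (openI (hB1 n).1 oW))
                   (conj (hU2 n).2 (conj (Qx n I) Wx))).
  exists N; split=> //; apply: nested_base => // z Nz.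
  have hz n : (U2 n `&` (B1 n `&` W)) z by apply: NU; exact: subset_closure.
  have Qz : Q z by move=> n _; have [_ []] := hz n.
  apply: U2Z => [|n]; last by have [] := hz n.
  split; first exact: QZ.
  case: (remainder_or_image i z) => // -[h zh]; exfalso.
  have zg : z = i g by rewrite zh; apply: QG; rewrite -zh.
  have : (W `&` V) z by split; [have [_ []] := hz 0 | rewrite zg; exact: Vg].
  by rewrite WV.
have [clg|nclg] := pselect (closure (Q `\` [set i g]) (i g)).
  have [|D [cD DQ Dg]] := tZ (i g) _ _ clg; first by move=> x [/QZ].
  have /choice[N hN] : forall z, exists N : nat -> set K, D z ->
      (forall n, open (N n) /\ N n z) /\
      forall O, open O -> O z -> exists n, N n `<=` O.
    move=> z; have [/DQ[Qz zg]|nD] := pselect (D z); last by exists (fun _ => set0).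
    by have [N hN] := Qbase z Qz zg; exists N.
  exists (\bigcup_(z in D) range (N z)), g; split.
  - by apply: bigcup_countable => // z _; exact: countable_image.
  - move=> _ [z Dz [n _ <-]]; have [/(_ n)[ oN Nz] _] := hN z Dz.
    by split=> //; exists z.
  - move=> O oO Og; have [z Dz Oz] := closure_meets Dg oO Og.
    have [_ /(_ O oO Oz)[n NO]] := hN z Dz.
    by exists (N z n) => //; exists z => //; exists n.
have [W [ oW Wg WQ]] : exists W, [/\ open W, W (i g) & forall x, W x -> Q x -> x = i g].
  exists (~` closure (Q `\` [set i g])); split=> //.
    by apply: closed_openC; exact: closed_closure.
  move=> x nx Qx; apply: contrapT => xg; apply: nx; exact: subset_closure.
have [N [hN NS NU]] := @nested_nbhs K hK cK (i g) (fun n => B1 n `&` W)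
  (fun n => conj (openI (hB1 n).1 oW) (conj (hB1 n).2 Wg)).
exists (range N), g; split.
- exact: countable_image.
- by move=> _ [n _ <-]; have [ oN Ng] := hN n; split=> //; exists (i g).
- have Nx x : (forall n, N n x) -> x = i g.
    move=> Nx; have hx n : (B1 n `&` W) x by apply: NU; exact: subset_closure.
    by apply: WQ => [|n _]; [have [] := hx 0 | have [] := hx n].
  by move=> O oO Og; have [n NO] := nested_base cK NS Nx oO Og; exists (N n) => //; exists n.
Qed.

(** Every member of the pi-base that is contained in a translate of [V] becomes a
    neighbourhood of 1 inside of [V^-1 * V] once it is translated by the inverse of
    one of its points [a P]. *)
Lemma group_first_countable : exists VB : set (set G), [/\ countable VB,
  forall V, VB V -> open V /\ V 1%g &
  forall W, open W -> W 1%g -> exists2 V, VB V & V `<=` W].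
Proof.
have [PB [g [cPB hPB PBg]]] := countable_pi_base.
have /choice[a ha] : forall P : set K, exists a : G, PB P -> P (i a).
  move=> P; have [PP|nP] := pselect (PB P); last by exists 1%g.
  by have [ oP [x Px]] := hPB P PP; have [a Pa] := dense_meets iD oP Px; exists a.
exists ((fun P => [set x | P (i (a P * x)%g)]) @` PB); split.
- exact: countable_image.
- move=> _ [P PP <-]; split; last by rewrite /= mulg1; exact: ha.
  exact: (open_lshift (a P) (open_preimage iE (hPB P PP).1)).
- move=> W oW W1; have [V [ oV V1 VW]] := open_divl oW W1.
  have [U [ oU UE]] := open_extension iE (open_lshift (g^-1)%g oV).
  have [|P PP PU] := PBg U oU; first by apply/UE; rewrite /= mulVg.
  exists [set x | P (i (a P * x)%g)]; first by exists P.
  move=> x /= /PU/UE /= Vx; have /PU/UE /= Va := ha P PP.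
  by rewrite -(mulKg (g^-1 * a P)%g x) -mulgA; exact: VW.
Qed.

(** A maximal uniformly discrete subset [D] is countable: move each [d] in [D] to a
    point [y d] of the remainder in a small neighbourhood [V d]. No point of the
    group is a limit of these, so that they have a compact closure [P] within the
    remainder. Locally [P] has a countable network by [compact_traced_network], and
    the pairwise disjoint open sets [V d] pick distinct members of it. *)
Lemma group_narrow (W : set G) : open W -> W 1%g ->
  exists D : set G, countable D /\ forall x : G, exists2 d, D d & W (d^-1 * x)%g.
Proof.
move=> oW W1.
pose S := W `&` [set x | W (x^-1)%g].
have oS : open S by apply: openI => //; exact: open_inv.
have S1 : S 1%g by split=> //=; rewrite invg1.
have SV (x : G) : S x -> S (x^-1)%g by move=> [? ?]; split=> //=; rewrite invgK.
pose sepd (D : set G) := forall d d', D d -> D d' -> d <> d' -> ~ S (d^-1 * d')%g.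
have [D [sD Dmax]] : exists D, sepd D /\ forall D', D `<` D' -> ~ sepd D'.
  apply: Zorn_bigcup => F FS Ftot d d' [A FA Ad] [B FB Bd'].
  have [AB|BA] := Ftot A B FA FB; first by apply: (FS B) => //; exact: AB.
  by apply: (FS A) => //; exact: BA.
exists D; split; last first.
  move=> x; apply: contrapT => nox.
  have Dx : ~ D x by move=> Dx; apply: nox; exists x => //; rewrite mulVg.
  apply: (Dmax (D `|` [set x])).
    split; first by move=> d Dd; left.
    by move=> /(_ x) h; apply: Dx; apply: h; right.
  have nS d : D d -> ~ S (d^-1 * x)%g.
    by move=> Dd [Wd _]; apply: nox; exists d.
  move=> d d' [Dd|->] [Dd'|->] dd'; [exact: sD|exact: nS| |by []].
  by move=> /SV; rewrite invgM invgK; exact: nS.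
have [W2 [ oW2 W21 W2S]] : exists V, [/\ open V, V 1%g &
    forall a b, V a -> V b -> S (a * b)%g].
  have [|U [V [ oU oV U1 V1 h]]] := @mulg_open _ _ 1%g 1%g oS; first by rewrite mulg1.
  by exists (U `&` V); split; [exact: openI|by []|move=> a b [Ua _] [_ Vb]; exact: h].
have [W1' [ oW1 W11 W1W2]] : exists V, [/\ open V, V 1%g &
    forall a b, V a -> V b -> W2 (a * b^-1)%g].
  have [|U [V [ oU oV U1 V1 h]]] := @mulg_open _ _ 1%g 1%g oW2; first by rewrite mulg1.
  exists (U `&` [set x | V (x^-1)%g]); split.
  - by apply: openI => //; exact: open_inv.
  - by split=> //=; rewrite invg1.
  - by move=> a b [Ua _] [_ Vb]; exact: h.
(* [d * W1'] and [d' * W1'] cannot both meet one translate [k * W1'] if [d] and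
   [d'] are distinct points of [D]. *)
have link (d d' k x x' : G) : W1' (d^-1 * x)%g -> W1' (k^-1 * x)%g ->
    W1' (k^-1 * x')%g -> W1' (d'^-1 * x')%g -> S (d^-1 * d')%g.
  move=> h1 h2 h3 h4; have := W2S _ _ (W1W2 _ _ h1 h2) (W1W2 _ _ h3 h4).
  by rewrite !invgM !invgK !mulgA !(mulgK, mulgVK).
have /choice[V hV] : forall d, exists V, open V /\ forall x : G, V (i x) <-> W1' (d^-1 * x)%g.
  by move=> d; exact: (open_extension iE (open_lshift (d^-1)%g oW1)).
have Vd d : V d (i d) by apply/(hV d).2; rewrite mulVg.
have /choice[y hy] : forall d, exists y, Y y /\ V d y.
  by move=> d; have [y Yy Vy] := YD (hV d).1 (Vd d); exists y.
have Vdisj d d' z : D d -> D d' -> V d z -> V d' z -> d = d'.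
  move=> Dd Dd' Vz V'z; apply: contrapT => dd'; apply: (sD _ _ Dd Dd' dd').
  have [x [/(hV d).2 h1 /(hV d').2 h2]] :=
    dense_meets iD (openI (hV d).1 (hV d').1) (conj Vz V'z).
  by apply: (@link d d' d d x); rewrite ?mulVg.
pose P := closure (y @` D).
have PY : P `<=` Y.
  move=> z Pz; case: (remainder_or_image i z) => // -[k zk]; exfalso; rewrite {}zk in Pz.
  have [_ [d Dd <-] Vkd] := closure_meets Pz (hV k).1 (Vd k).
  have [|U1 [U2 [ oU1 oU2 U1k U2d U12]]] := @open_separation _ hK (i k) (y d).
    by move=> E; have := (hy d).1; rewrite -E; exact: image_notin_remainder.
  have [_ [d' Dd' <-] [Vkd' U1d']] :=
    closure_meets Pz (openI (hV k).1 oU1) (conj (Vd k) U1k).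
  have dd' : d <> d'.
    move=> E; have : (U1 `&` U2) (y d) by split=> //; rewrite E.
    by rewrite U12.
  have [x [/(hV k).2 h1 /(hV d).2 h2]] :=
    dense_meets iD (openI (hV k).1 (hV d).1) (conj Vkd (hy d).2).
  have [x' [/(hV k).2 h3 /(hV d').2 h4]] :=
    dense_meets iD (openI (hV k).1 (hV d').1) (conj Vkd' (hy d').2).
  exact: (sD _ _ Dd Dd' dd' (link _ _ _ _ _ h2 h1 h3 h4)).
have cP : compact P by apply: closed_compactT => //; exact: closed_closure.
have [|U U' _ _ cU cU'|z Pz|U [_ PU cU]] :=
    @compact_local_to_global K P [set U | countable [set d | D d /\ U (y d)]] cP.
- by rewrite /=; apply: (@countable_subset _ _ set0); [move=> d [] | exact: countable0].
- rewrite /=; apply: countable_subset (countable_setU cU cU').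
  by move=> d [Dd [Ud|Ud]]; [left|right].
- have [ O [e [ oO Oz he]]] := Yloc (PY z Pz).
  have [A [ oA Az AO]] := shrink_nbhs hK cK oO Oz.
  have [N hN] : countable_network (P `&` closure A).
    apply: (@compact_traced_network _ hK cK _ e).
      by apply: traced_separationS he => x [/PY Yx /AO].
    by apply: closed_compactT => //; apply: closedI; exact: closed_closure.
  exists A; split=> //=.
  have /choice[f hf] : forall d, exists n, D d -> A (y d) -> N n (y d) /\ N n `<=` V d.
    move=> d; have [[Dd Ad]|no] := pselect (D d /\ A (y d)).
      have [|n hn] := hN (y d) _ (V d) (hV d).1 (hy d).2; last by exists n.
      by split; apply: subset_closure => //; exists d.
    by exists 0 => Dd Ad; exfalso; apply: no.
  apply/countable_injP; exists f => d d' /set_mem[Dd Ad] /set_mem[Dd' Ad'] ff.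
  have [Nd NV] := hf d Dd Ad; have [Nd' NV'] := hf d' Dd' Ad'.
  by apply: (@Vdisj _ _ (y d)) => //; [exact: (hy d).2 | apply: NV'; rewrite -ff].
- apply: countable_subset cU => d Dd; split=> //; apply: PU.
  by apply: subset_closure; exists d.
Qed.

Lemma group_second_countable : exists b : nat -> set G,
  (forall n, open (b n)) /\ forall g U, open U -> U g ->
    exists n, b n g /\ b n `<=` U.
Proof.
have [VB [cVB hVB VBW]] := group_first_countable.
have /choice[D hD] : forall V : set G, exists D : set G, VB V ->
    countable D /\ forall x : G, exists2 d, D d & V (d^-1 * x)%g.
  move=> V; have [/hVB[ oV V1]|nV] := pselect (VB V); last by exists set0.
  by have [D hD] := group_narrow oV V1; exists D.
pose BB := \bigcup_(V in VB) ((fun d => [set x | V (d^-1 * x)%g]) @` D V).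
have cBB : countable BB.
  apply: bigcup_countable => // V VV; apply: countable_image; exact: (hD V VV).1.
have [b [hb bB]] := countable_enum set0 cBB.
exists b; split.
  move=> n; case: (hb n) => [[V VV [d _ <-]]|->]; last exact: open0.
  exact: (open_lshift (d^-1)%g (hVB V VV).1).
move=> g U oU Ug.
have [|W [ oW W1 WU]] := @open_divl _ _ (open_lshift g oU); first by rewrite /= mulg1.
have [V VV VW] := VBW W oW W1; have [d Dd Vd] := (hD V VV).2 g.
have [|n bn] := bB [set x | V (d^-1 * x)%g]; first by exists V => //; exists d.
exists n; rewrite bn; split=> // x /= Vx.
have /= := WU _ _ (VW _ Vd) (VW _ Vx).
by rewrite invgM invgK !mulgA mulgV mul1g mulgV mul1g.
Qed.

(** A countable base of [G] extends to open sets [O n] of [K] that separate the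
    points of [G] from those of [Y]. Hence for [y] in [Y] the points of [K] that lie
    in no [O n] missing [y] form a compact subset of [Y], and finite intersections
    of the complements of the [O n] are a countable network modulo these compact
    sets. So [traced_network] applies to the pieces of [Y] on which there is a
    traced separation, and countably many of those pieces cover [Y]. *)
Lemma compactification_network : countable_network [set: K].
Proof.
have [b [ ob hb]] := group_second_countable.
pose O n := ~` closure (i @` (~` b n)).
have oO n : open (O n) by apply: closed_openC; exact: closed_closure.
have Ob n g : b n g -> O n (i g).
  move=> bg; have [V [ oV VE]] := open_extension iE (ob n).
  have Vg : V (i g) by exact/VE.
  move=> clg; have [_ [h nbh <-] Vh] := closure_meets clg oV Vg.
  by apply: nbh; exact/VE.
have bO n g : O n (i g) -> b n g.
  move=> Og; apply: contrapT => nb; apply: Og; apply: subset_closure.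
  by exists g.
have O_separates g y : Y y -> exists n, O n (i g) /\ ~ O n y.
  move=> Yy; have [|U [V [ oU oV Ug Vy UV]]] := @open_separation _ hK (i g) y.
    by move=> E; apply: (@image_notin_remainder _ _ i g); rewrite E.
  have [n [bg bU]] := hb g _ (open_preimage iE oU) Ug.
  exists n; split; first exact: Ob.
  move=> Oy; have [h [ Oh Vh]] := dense_meets iD (openI (oO n) oV) (conj Oy Vy).
  have : (U `&` V) (i h) by split=> //; apply: bU; exact: bO.
  by rewrite UV.
pose C (k : nat) := if unpickle k is Some s then
  [set z | forall n, n \in (s : seq nat) -> ~ O n z] else set0.
(* [KK A y] is the compact set of the points of [A] that the [O n] do not
   separate from [y]. *)
pose KK (A : set K) y := [set z | A z /\ forall n, ~ O n y -> ~ O n z].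
have KKY A y : Y y -> KK A y `<=` Y.
  move=> Yy z [_ hz]; case: (remainder_or_image i z) => // -[g zg]; exfalso.
  by have [n [ Og nOy]] := O_separates g y Yy; apply: (hz n nOy); rewrite zg.
have KKc A y : closed A -> compact (KK A y).
  move=> cA; apply: closed_compactT => //.
  have -> : KK A y = A `&` \bigcap_(n in [set n | ~ O n y]) (~` O n) by [].
  by apply: closedI => //; apply: closed_bigI => n _; exact: open_closedC.
have KKC A y W : closed A -> open W -> KK A y `<=` W ->
    exists m, C m y /\ C m `&` A `<=` W.
  move=> cA oW KW.
  pose F := filter_from [set s : seq nat | forall n, n \in s -> ~ O n y]
    (fun s => A `&` [set z | forall n, n \in s -> ~ O n z]).
  have FF : Filter F.
    apply: filter_from_filter; first by exists [::].
    move=> s t hs ht; exists (s ++ t).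
      by move=> n; rewrite mem_cat => /orP[/hs|/ht].
    move=> z [Az hz]; split; split=> // n hn; apply: hz;
      by rewrite mem_cat hn ?orbT.
  have F_meets (s : seq nat) z V : (forall n, n \in s -> ~ O n y) -> cluster F z ->
      open V -> V z -> exists x, [/\ A x, V x & forall n, n \in s -> ~ O n x].
    move=> hs Fz oV Vz.
    have [|x [[Ax hx] Vx]] := Fz (A `&` [set z | forall n, n \in s -> ~ O n z]) V _
      (open_nbhs_nbhs (conj oV Vz)); last by exists x.
    by exists s.
  have [|s hs sW] := cluster_sub_open cK FF oW.
    move=> z Fz; apply: KW; split.
      apply: cA; apply: closure_of_open => V oV Vz.
      by have [//|x [Ax Vx _]] := F_meets [::] z V _ Fz oV Vz; exists x.
    move=> n nOy Oz.
    have [m|x [_ Ox hx]] := F_meets [:: n] z (O n) _ Fz (oO n) Oz.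
      by rewrite inE => /eqP ->.
    by apply: (hx n _ Ox); rewrite mem_head.
  exists (pickle s); rewrite /C pickleK; split=> // z [hz Az].
  exact: sW.
have Yloc_net y : Y y -> exists V, [/\ open V, V y & countable_network (V `&` Y)].
  move=> Yy; have [U [e [ oU Uy he]]] := Yloc Yy.
  have [V [ oV Vy VU]] := shrink_nbhs hK cK oU Uy.
  exists V; split=> //; apply: (@countable_networkS _ (closure V `&` Y)).
    by apply: setSI; exact: subset_closure.
  apply: (@traced_network _ hK cK _ e C (KK (closure V))).
  - by apply: traced_separationS he => x [/VU].
  - move=> x [cx Yx]; split; first by apply: KKc; exact: closed_closure.
    by move=> z Kz; split; [case: Kz | exact: KKY Kz].
  - move=> x [cx Yx] W oW KW.
    have [k [Cx CW]] := KKC _ x W (@closed_closure _ V) oW KW.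
    by exists k; split=> // z [Cz [cz _]]; exact: CW.
have netY : countable_network Y.
  pose X (k : nat) := [set z | countable_network (C k `&` Y) /\ (C k `&` Y) z].
  apply: (@countable_networkS _ (\bigcup_k X k)); last first.
    apply: countable_network_bigcup => k.
    have [h|h] := pselect (countable_network (C k `&` Y)).
      by apply: countable_networkS h => z [].
    by exists (fun _ => set0) => z [].
  move=> y Yy.
  have [|U V _ _ hU hV|z Kz|V [ oV KV hV]] :=
    @compact_local_to_global K (KK setT y) [set V | countable_network (V `&` Y)] (KKc _ y closedT).
  - by exists (fun _ => set0) => z [].
  - by rewrite /= setIUl; exact: countable_networkU.
  - exact: Yloc_net (KKY _ _ Yy _ Kz).
  have [k [Cy CV]] := KKC setT y V closedT oV KV.
  exists k => //; split; last by split.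
  by apply: countable_networkS hV => z [Cz Yz]; split => //; apply: CV; split.
apply: (@countable_networkS _ (Y `|` range i)).
  by move=> x _; case: (remainder_or_image i x) => [|[g ->]]; [left | right; exists g].
apply: countable_networkU => //; exists (fun n => i @` b n).
move=> _ [g _ <-] W oW Wg; have [n [bg bW]] := hb g _ (open_preimage iE oW) Wg.
by exists n; split; [exists g | move=> _ [h bh <-]; exact: bW].
Qed.

End Remainder.

Theorem theorem6p21 (R : realType) (G : topologicalGroupType)
    (bG : topologicalType) (i : G -> bG) :
  tychonoff_space G ->
  ~ locally_compact [set: G] ->
  hausdorff_compactification i ->
  has_locally_point_countable_p_metabase (remainder i) ->
  [/\ separable G, metrizable R G, separable bG & metrizable R bG].
Proof.
move=> _ nlc [cK hK iE iD] /locally_p_metabase_traced Yloc.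
have YD := remainder_dense hK cK iE iD nlc.
have net := compactification_network hK cK iE iD Yloc YD.
have mK : metrizable R bG by exact: countable_network_metrizable.
have idE : topological_embedding (id : bG -> bG).
  split; [exact: inj_id | by move=> x | move=> U oU; exists U => //].
  by rewrite image_id (_ : range id = setT) ?setIT// -subTset => x _; exists x.
split=> //.
- exact: countable_network_separable iE net.
- exact: metrizable_embedding iE mK.
- exact: countable_network_separable idE net.
Qed.
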